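(* Consider the composite optimization problem $$\text{minimize }\ \varphi_0(x)+(\vartheta\circ f)(x)\ \text{ over }x\in\mathbb{R}^n,\qquad(\mathrm{P})$$ and assume that $\varphi_0\colon\mathbb{R}^n\to\mathbb{R}$ and $f\colon\mathbb{R}^n\to\mathbb{R}^m$ are $\mathcal{C}^2$-smooth around $\bar x$, and that $\vartheta\colon\mathbb{R}^m\to\overline{\mathbb{R}}$ is convex piecewise linear-quadratic with $f(\bar x)\in\operatorname{dom}\vartheta$. Let $(\bar x,\bar\lambda)$ be a solution to the KKT system $\nabla_xL(x,\lambda)=0$, $\lambda\in\partial\vartheta(f(x))$. Define $G\colon\mathbb{R}^n\times\mathbb{R}^m\rightrightarrows\mathbb{R}^n\times\mathbb{R}^m$ by $$G(x,\lambda):=\begin{bmatrix}\nabla_xL(x,\lambda)\\-f(x)\end{bmatrix}+\begin{bmatrix}0\\(\partial\vartheta)^{-1}(\lambda)\end{bmatrix}.$$ Then the following conditions are equivalent: (i) The mapping $G$ is strongly metrically subregular at $((\bar x,\bar\lambda),(0,0))$, and $\bar x$ is a local minimizer for (P). (ii) $\Lambda(\bar x,\bar v)=\{\bar\lambda\}$ with $\bar v:=-\nabla\varphi_0(\bar x)$, and the second-order sufficient condition $$\mathrm{d}^2\vartheta\big(f(\bar x),\bar\lambda\big)\big(\nabla f(\bar x)w\big)+\langle\nabla^2_{xx}L(\bar x,\bar\lambda)w,w\rangle>0$$ holds for all $w\in\mathbb{R}^n\setminus\{0\}$ satisfying $\nabla f(\bar x)w\in K_\vartheta(f(\bar x),\bar\lambda)$.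 (iii) The second-order sufficient condition displayed in (ii) (for all $w\in\mathbb{R}^n\setminus\{0\}$ with $\nabla f(\bar x)w\in K_\vartheta(f(\bar x),\bar\lambda)$) and the strong Robinson constraint qualification $$\big(D\partial\vartheta\big)\big(f(\bar x),\bar\lambda\big)(0)\cap\ker\nabla f(\bar x)^*=\{0\}$$ are both satisfied.
   Context: $\overline{\mathbb{R}}:=(-\infty,\infty]$, $\operatorname{dom}\vartheta:=\{y\mid\vartheta(y)<\infty\}$; $^*$ on matrices denotes transpose. The Lagrangian is $L(x,\lambda):=\varphi_0(x)+\langle\lambda,f(x)\rangle-\vartheta^*(\lambda)$, with $\vartheta^*$ the Fenchel conjugate; thus $\nabla_xL(x,\lambda)=\nabla\varphi_0(x)+\nabla f(x)^*\lambda$ and $\nabla^2_{xx}L(x,\lambda)=\nabla^2\varphi_0(x)+\nabla^2\langle\lambda,f\rangle(x)$. Multiplier set: $\Lambda(\bar x,\bar v):=\{\lambda\in\mathbb{R}^m\mid\nabla f(\bar x)^*\lambda=\bar v,\ \lambda\in\partial\vartheta(f(\bar x))\}$. $\vartheta$ is piecewise linear-quadratic if $\operatorname{dom}\vartheta=\bigcup_{i=1}^s\Omega_i$ with polyhedral convex sets $\Omega_i$ and $\vartheta(y)=\frac12\langle A_iy,y\rangle+\langle a_i,y\rangle+\alpha_i$ for $y\in\Omega_i$, with symmetric matrices $A_i$, $a_i\in\mathbb{R}^m$, $\alpha_i\in\mathbb{R}$. $\partial\vartheta$ is the subdifferential of convex analysis. Subderivative: $\mathrm{d}\vartheta(\bar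 y)(\bar w):=\liminf_{t\downarrow 0,\,w\to\bar w}\frac{\vartheta(\bar y+tw)-\vartheta(\bar y)}{t}$. Second subderivative: $\mathrm{d}^2\vartheta(\bar y,\bar u)(w):=\liminf_{t\downarrow0,\,w'\to w}\frac{\vartheta(\bar y+tw')-\vartheta(\bar y)-t\langle\bar u,w'\rangle}{\frac12t^2}$. Critical cone: $K_\vartheta(\bar y,\bar u):=\{w\mid\mathrm{d}\vartheta(\bar y)(w)=\langle\bar u,w\rangle\}$. Tangent cone: $T_\Omega(\bar x):=\{w\mid\exists\,t_k\downarrow0,\ w_k\to w,\ \bar x+t_kw_k\in\Omega\}$. Graphical derivative of a set-valued mapping $S$ at $(\bar x,\bar y)\in\operatorname{gph}S$: $DS(\bar x,\bar y)(u):=\{v\mid(u,v)\in T_{\operatorname{gph}S}(\bar x,\bar y)\}$. $S$ is strongly metrically subregular at $(\bar x,\bar y)\in\operatorname{gph}S$ if there are $\kappa\ge0$ and a neighborhood $U$ of $\bar x$ with $\|x-\bar x\|\le\kappa\operatorname{dist}(\bar y;S(x))$ for all $x\in U$ (with $\operatorname{dist}(\bar y;\emptyset)=\infty$). *)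

(* Defs.v *)
From HB Require Import structures.
From mathcomp Require Import all_boot all_order all_algebra.
From mathcomp Require Import all_classical all_reals all_analysis.

Set Implicit Arguments.
Unset Strict Implicit.
Unset Printing Implicit Defensive.

Import Order.TTheory GRing.Theory Num.Theory.
Import numFieldNormedType.Exports.

Local Open Scope classical_set_scope.
Local Open Scope ring_scope.

(* Vectors of R^n are row vectors, as in the library's Jacobian, for which
   'D_w f x = w *m 'J f x.  Hence nabla f(x) w is w *m 'J f x, the adjoint
   nabla f(x)^* lambda is lambda *m ('J f x)^T, and, for a symmetric matrix A,
   A y is y *m A. *)

Definition dot (R : realType) (n : nat) (u v : 'rV[R]_n) : R :=
  \sum_i u 0 i * v 0 i.

(* The library norms on 'rV[R]_n and on products are max norms; they are used
   only through the topology they induce. *)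
Definition enorm (R : realType) (n : nat) (u : 'rV[R]_n) : R :=
  Num.sqrt (dot u u).

Definition prod_enorm (R : realType) (n m : nat)
    (z : 'rV[R]_n * 'rV[R]_m) : R :=
  Num.sqrt (enorm z.1 ^+ 2 + enorm z.2 ^+ 2).

Section SmoothFunctions.
Context {R : realType}.

Definition C2_around (n : nat) (W : normedModType R) (h : 'rV[R]_n -> W)
    (x : 'rV[R]_n) : Prop :=
  \forall y \near x,
    [/\ differentiable h y,
        forall v, differentiable ('D_v h) y
      & forall u v, {for y, continuous ('D_u ('D_v h))}].

Definition gradient (n : nat) (phi : 'rV[R]_n -> R) (x : 'rV[R]_n) : 'rV[R]_n :=
  \row_i 'D_(delta_mx 0 i) phi x.

Definition hessian (n : nat) (phi : 'rV[R]_n -> R) (x : 'rV[R]_n) : 'M[R]_n :=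
  'J (gradient phi) x.

End SmoothFunctions.

Section VariationalAnalysis.
Context {R : realType}.

Definition tangent_cone (V : normedModType R) (Omega : set V) (x : V) : set V :=
  [set w | exists (t : R^nat) (u : V^nat),
    [/\ forall k, 0 < t k, t @ \oo --> (0 : R), u @ \oo --> w
      & forall k, Omega (x + t k *: u k)]].

Definition graph_of (X Y : Type) (S : X -> set Y) : set (X * Y) :=
  [set z | S z.1 z.2].

Definition inverse_map (X Y : Type) (S : X -> set Y) (y : Y) : set X :=
  [set x | S x y].

Definition graphical_derivative (X Y : normedModType R) (S : X -> set Y)
    (x : X) (y : Y) (u : X) : set Y :=
  [set v | tangent_cone (graph_of S) (x, y) (u, v)].

Definition dist (Y : zmodType) (normY : Y -> R) (y : Y) (A : set Y) : \bar R :=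
  ereal_inf [set (normY (y - z))%:E | z in A].

Definition strongly_metrically_subregular (X Y : normedModType R)
    (normX : X -> R) (normY : Y -> R) (S : X -> set Y) (xbar : X) (ybar : Y)
    : Prop :=
  S xbar ybar /\
  exists2 kappa : R, 0 <= kappa &
    \forall x \near xbar,
      ((normX (x - xbar))%:E <= kappa%:E * dist normY ybar (S x))%E.

Definition edom (T : Type) (theta : T -> \bar R) : set T :=
  [set y | (theta y < +oo)%E].

Definition local_minimizer (V : normedModType R) (g : V -> \bar R) (x : V)
    : Prop :=
  edom g x /\ \forall y \near x, (g x <= g y)%E.

Variable m : nat.
Implicit Types (theta : 'rV[R]_m -> \bar R) (y u w lambda : 'rV[R]_m).

Definition convex_efun theta : Prop :=
  forall y1 y2 (t : R), 0 < t -> t < 1 ->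
    (theta (t *: y1 + (1 - t) *: y2)%R
       <= t%:E * theta y1 + (1 - t)%R%:E * theta y2)%E.

Definition polyhedral (Omega : set 'rV[R]_m) : Prop :=
  exists (k : nat) (b : 'I_k -> 'rV[R]_m) (beta : 'I_k -> R),
    Omega = [set y | forall j, dot (b j) y <= beta j].

Definition piecewise_linear_quadratic theta : Prop :=
  exists (s : nat) (Omega : 'I_s -> set 'rV[R]_m) (A : 'I_s -> 'M[R]_m)
         (a : 'I_s -> 'rV[R]_m) (alpha : 'I_s -> R),
    [/\ forall i, polyhedral (Omega i),
        forall i, (A i)^T = A i,
        edom theta = \bigcup_i Omega i
      & forall i y, Omega i y ->
          theta y = (2^-1 * dot (y *m A i) y + dot (a i) y + alpha i)%:E].

Definition subdifferential theta y : set 'rV[R]_m :=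
  [set lambda | edom theta y /\
    forall z, (theta y + (dot lambda (z - y)%R)%:E <= theta z)%E].

Definition subderivative theta y w : \bar R :=
  limf_einf
    (fun p : R * 'rV[R]_m => ((theta (y + p.1 *: p.2)%R - theta y) * (p.1^-1)%R%:E)%E)
    (filter_prod 0^'+ (nbhs w)).

Definition second_subderivative theta y u w : \bar R :=
  limf_einf
    (fun p : R * 'rV[R]_m =>
       ((theta (y + p.1 *: p.2)%R - theta y - (p.1 * dot u p.2)%R%:E)
          * ((2^-1 * p.1 ^+ 2)^-1)%R%:E)%E)
    (filter_prod 0^'+ (nbhs w)).

Definition critical_cone theta y u : set 'rV[R]_m :=
  [set w | subderivative theta y w = (dot u w)%:E].

End VariationalAnalysis.

Section CompositeOptimization.
Context {R : realType} {n m : nat}.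
Variables (phi0 : 'rV[R]_n -> R) (f : 'rV[R]_n -> 'rV[R]_m)
  (theta : 'rV[R]_m -> \bar R).
Implicit Types (x v : 'rV[R]_n) (lambda : 'rV[R]_m).

Definition objective x : \bar R := ((phi0 x)%:E + theta (f x))%E.

(* The Lagrangian is phi0 x + <lambda, f x> - theta^* lambda; its last term does
   not depend on x and so does not enter the x-derivatives below. *)
Definition grad_lagrangian x lambda : 'rV[R]_n :=
  gradient phi0 x + lambda *m ('J f x)^T.

Definition hess_lagrangian x lambda : 'M[R]_n :=
  hessian phi0 x + hessian (fun x' => dot lambda (f x')) x.

Definition KKT x lambda : Prop :=
  grad_lagrangian x lambda = 0 /\ subdifferential theta (f x) lambda.

Definition multipliers x v : set 'rV[R]_m :=
  [set lambda | lambda *m ('J f x)^T = v /\ subdifferential theta (f x) lambda].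

Definition KKT_map (z : 'rV[R]_n * 'rV[R]_m) : set ('rV[R]_n * 'rV[R]_m) :=
  [set (grad_lagrangian z.1 z.2, - f z.1 + y)
    | y in inverse_map (subdifferential theta) z.2].

Definition SOSC x lambda : Prop :=
  forall w : 'rV[R]_n, w != 0 ->
    critical_cone theta (f x) lambda (w *m 'J f x) ->
    (0 < second_subderivative theta (f x) lambda (w *m 'J f x)
         + (dot (w *m hess_lagrangian x lambda) w)%:E)%E.

Definition strong_Robinson_CQ x lambda : Prop :=
  graphical_derivative (subdifferential theta) (f x) lambda 0
    `&` [set eta | eta *m ('J f x)^T = 0] = [set 0].

End CompositeOptimization.

(* Main.v *)
Require Import Defs.
From HB Require Import structures.
From mathcomp Require Import all_boot all_order all_algebra.
From mathcomp Require Import all_classical all_reals all_analysis.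
From mathcomp Require Import ring lra.

Set Implicit Arguments.
Unset Strict Implicit.
Unset Printing Implicit Defensive.

Import Order.TTheory GRing.Theory Num.Theory.
Import numFieldNormedType.Exports.

Local Open Scope classical_set_scope.
Local Open Scope ring_scope.

(** The three conditions are proved equivalent in a cycle.  Throughout,
    [J = 'J f xbar], [H] is the Hessian of the Lagrangian at [(xbar, lbar)],
    and the second-order condition is used in the form: for no [w != 0] is the
    second subderivative of [theta] at [w *m J] bounded by [- dot (w *m H) w]
    ([SOSC_low_curvatureP]).

    From (i) to (ii).  Multipliers form a convex set and subregularity isolates
    [lbar] in it ([subregular_unique_multiplier]).  For the second-order
    condition ([subregular_SOSC]), the augmented Lagrangian is minimized with a
    proximal term centred at [xbar + t *: w], where [w] is a direction in which
    the condition fails.  A minimizer solves a perturbed KKT system, to which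
    subregularity applies: it is so close to [xbar] that it pays for the
    proximal term, while a point close to [xbar + t *: w] has a smaller value
    ([low_curvature_competitor]).  Uniqueness of the multiplier enters as a
    constraint qualification, in the convergence of the multipliers of the
    minimizers ([multiplier_cvg]).

    From (ii) to (iii).  A direction in the graphical derivative of the
    subdifferential at [0] is a direction in which [lbar] can be moved within
    the subdifferential at [f xbar] ([graphical_derivative0_subgradient]); if
    it is in the kernel of the adjoint of [J], this produces a second
    multiplier.  Here the polyhedral structure is essential, and it enters
    through Farkas' lemma.

    From (iii) to (i).  Local minimality is the classical contradiction argument
    ([SOSC_local_minimizer]).  If subregularity fails, a limit of normalized
    differences is a nonzero pair [(w, eta)] with [eta] in the graphical
    derivative of the subdifferential at [w *m J] and
    [w *m H + eta *m J^T = 0] ([SOSC_RCQ_subregular]).  The pair is excluded by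
    the strong Robinson condition if [w = 0], and otherwise by the second-order
    condition, because [dot eta (w *m J)] bounds the second subderivative at
    [w *m J] ([graphical_derivative_low_curvature]). *)

(** * Inner product and limits of vectors *)
Section DotProduct.
Context {R : realType} {n : nat}.
Implicit Types (u v w : 'rV[R]_n) (a : R).

Lemma dotC u v : dot u v = dot v u.
Proof. by apply: eq_bigr => i _; rewrite mulrC. Qed.

Lemma dotDl u v w : dot (u + v) w = dot u w + dot v w.
Proof. by rewrite -big_split; apply: eq_bigr => i _; rewrite mxE mulrDl. Qed.

Lemma dotZl a u v : dot (a *: u) v = a * dot u v.
Proof. by rewrite mulr_sumr; apply: eq_bigr => i _; rewrite mxE mulrA. Qed.

Lemma dotDr u v w : dot w (u + v) = dot w u + dot w v.
Proof. by rewrite !(dotC w) dotDl. Qed.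

Lemma dotZr a u v : dot v (a *: u) = a * dot v u.
Proof. by rewrite !(dotC v) dotZl. Qed.

Lemma dotNl u v : dot (- u) v = - dot u v.
Proof. by rewrite -scaleN1r dotZl mulN1r. Qed.

Lemma dotNr u v : dot v (- u) = - dot v u.
Proof. by rewrite !(dotC v) dotNl. Qed.

Lemma dotBl u v w : dot (u - v) w = dot u w - dot v w.
Proof. by rewrite dotDl dotNl. Qed.

Lemma dotBr u v w : dot w (u - v) = dot w u - dot w v.
Proof. by rewrite dotDr dotNr. Qed.

Lemma dot0l u : dot 0 u = 0.
Proof. by rewrite -(scale0r 0) dotZl mul0r. Qed.

Lemma dot0r u : dot u 0 = 0.
Proof. by rewrite dotC dot0l. Qed.

Definition dotE := (dotDl, dotDr, dotZl, dotZr, dotNl, dotNr, dot0l, dot0r).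

Lemma dot_ge0 u : 0 <= dot u u.
Proof. by apply: sumr_ge0 => i _; rewrite -expr2 sqr_ge0. Qed.

Lemma dot_eq0 u : (dot u u == 0) = (u == 0).
Proof.
apply/idP/eqP => [|->]; last by rewrite dot0l.
rewrite psumr_eq0 => [/allP u0|i _]; last by rewrite -expr2 sqr_ge0.
apply/rowP => i; apply/eqP; rewrite mxE -sqrf_eq0 expr2.
by apply: u0; rewrite mem_index_enum.
Qed.

Lemma dot_gt0 u : u != 0 -> 0 < dot u u.
Proof. by rewrite lt_def dot_ge0 dot_eq0 andbT. Qed.

Lemma normr_entry_le (p q : nat) (A : 'M[R]_(p, q)) i j : `|A i j| <= `|A|.
Proof.
rewrite [leRHS]/Num.Def.normr/= mx_normrE.
exact: (le_bigmax _ (fun ij => `|A ij.1 ij.2|) (i, j)).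
Qed.

Lemma dot_le_norm u v : `|dot u v| <= n%:R * (`|u| * `|v|).
Proof.
rewrite (le_trans (ler_norm_sum _ _ _))//.
rewrite (@le_trans _ _ (\sum_(i < n) `|u| * `|v|))//.
  by apply: ler_sum => i _; rewrite normrM ler_pM ?normr_entry_le.
by rewrite sumr_const card_ord mulr_natl.
Qed.

Lemma norm_le_dot u : `|u| ^+ 2 <= dot u u.
Proof.
have [->|u0] := eqVneq u 0; first by rewrite normr0 expr0n dot_ge0.
have [[i j] ->] : exists ij, `|u| = `|u ij.1 ij.2|.
  by apply: mx_norm_neq0; apply: contra_neq u0; exact: mx_norm_eq0.
rewrite /= (ord1 i) real_normK ?num_real//.
rewrite /dot (bigD1 j)//= -expr2 lerDl.
by apply: sumr_ge0 => k _; rewrite -expr2 sqr_ge0.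
Qed.

Lemma dot_mulmx (p : nat) (x : 'rV[R]_p) (A : 'M[R]_(p, n)) v :
  dot (x *m A) v = dot x (v *m A^T).
Proof.
rewrite /dot; under eq_bigr do rewrite mxE mulr_suml.
rewrite exchange_big/=; apply: eq_bigr => i _.
rewrite mxE mulr_sumr; apply: eq_bigr => j _.
by rewrite mxE mulrA mulrAC -mulrA.
Qed.

End DotProduct.

Section VectorLimits.
Context {R : realType} {T : Type} {F : set_system T} {FF : Filter F}.

Lemma cvg_mxP (p q : nat) (u : T -> 'M[R]_(p, q)) (a : 'M[R]_(p, q)) :
  u @ F --> a <-> forall i j, (fun k => u k i j) @ F --> a i j.
Proof.
split=> [ua i j|ua].
  apply/cvgrPdist_le => e e0; move/cvgrPdist_le: ua => /(_ e e0).
  apply: filterS => k; apply: le_trans.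
  by have := normr_entry_le (a - u k) i j; rewrite !mxE.
apply/cvgrPdist_le => e e0; near=> k.
rewrite [leLHS]/Num.Def.normr/= mx_normrE (bigmax_le _ (ltW e0))//= => ij _.
rewrite !mxE; move: ij; near: k; apply: filter_forall => -[i j] /=.
by move/cvgrPdist_le: (ua i j); exact.
Unshelve. all: by end_near. Qed.

Lemma cvg_mulmx (p q r : nat) (u : T -> 'M[R]_(p, q)) (v : T -> 'M[R]_(q, r))
    (a : 'M[R]_(p, q)) (b : 'M[R]_(q, r)) :
  u @ F --> a -> v @ F --> b -> (fun k => u k *m v k) @ F --> a *m b.
Proof.
move=> /cvg_mxP ua /cvg_mxP vb; apply/cvg_mxP => i j.
under eq_fun do rewrite mxE; rewrite mxE.
by apply: cvg_big => [|l _]; [exact: add_continuous|exact: cvgM].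
Qed.

Lemma cvg_trmx (p q : nat) (u : T -> 'M[R]_(p, q)) (a : 'M[R]_(p, q)) :
  u @ F --> a -> (fun k => (u k)^T) @ F --> a^T.
Proof.
move=> /cvg_mxP ua; apply/cvg_mxP => i j.
by rewrite mxE; under eq_fun do rewrite mxE; exact: ua.
Qed.

Lemma cvg_dot (p : nat) (u v : T -> 'rV[R]_p) (a b : 'rV[R]_p) :
  u @ F --> a -> v @ F --> b -> (fun k => dot (u k) (v k)) @ F --> dot a b.
Proof.
move=> /cvg_mxP ua /cvg_mxP vb.
by apply: cvg_big => [|l _]; [exact: add_continuous|exact: cvgM].
Qed.

Lemma cvg_add_scale (V : normedModType R) (x : V) (t : T -> R)
    (v : T -> V) (w : V) :
  t @ F --> (0 : R) -> v @ F --> w -> (fun k => x + t k *: v k) @ F --> x.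
Proof.
move=> t0 vw; have : (fun k => x + t k *: v k) @ F --> x + 0 *: w.
  by apply: cvgD; [exact: cvg_cst|exact: cvgZ].
by rewrite scale0r addr0.
Qed.

Lemma cvg_dot0 (p : nat) (u : T -> 'rV[R]_p) :
  (fun k => dot (u k) (u k)) @ F --> (0 : R) -> u @ F --> (0 : 'rV[R]_p).
Proof.
move=> uu; apply/cvgr0Pnorm_lt => e e0.
have : \forall k \near F, dot (u k) (u k) < e ^+ 2.
  by apply: (cvgr_lt _ uu); rewrite exprn_gt0.
apply: filterS => k uk.
by rewrite -(ltr_pXn2r (n:=2)) ?nnegrE ?(ltW e0)// (le_lt_trans (norm_le_dot _)).
Qed.

Lemma cvg_pair_normed (V W : normedModType R) (g : T -> V) (h : T -> W)
    (a : V) (b : W) :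
  g @ F --> a -> h @ F --> b -> (fun k => (g k, h k)) @ F --> (a, b).
Proof. by move=> ga hb; exact: (@cvg_pair _ _ _ F (nbhs a) (nbhs b)). Qed.

End VectorLimits.

Lemma dot_continuous (R : realType) (p : nat) (b : 'rV[R]_p) :
  continuous (dot b).
Proof.
by move=> y; apply: (@cvg_dot R _ (nbhs y) _ p (fun=> b) id) => //; exact: cvg_cst.
Qed.

Lemma limit_unique (R : realType) (V : normedModType R) (T : Type)
    (F : set_system T) (u : T -> V) (a b : V) : ProperFilter F ->
  u @ F --> a -> u @ F --> b -> a = b.
Proof. by move=> FF; exact: norm_cvg_unique. Qed.

Lemma cvg_dist_harmonic (R : realType) (V : normedModType R) (v : nat -> V)
    (w : V) :
  (forall k, `|v k - w| <= harmonic k) -> v @ \oo --> w.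
Proof.
move=> vP; apply/cvgrPdistC_lt => e e0.
have : \forall k \near \oo, harmonic k < e by exact: (cvgr_lt _ cvg_harmonic).
by apply: filterS => k; exact: le_lt_trans.
Qed.

(** Contradiction arguments start from here: a property that fails arbitrarily
    close to a point fails along a sequence with an explicit rate, and the
    property may be strengthened along the sequence. *)
Lemma not_near_seq (R : realType) (V : normedModType R) (zbar : V)
    (P : nat -> V -> Prop) :
  (forall k, ~ \forall z \near zbar, P k z) ->
  exists z : V^nat, forall k, `|z k - zbar| < harmonic k /\ ~ P k (z k).
Proof.
move=> nP.
suff /choice[z zP] k : exists z, `|z - zbar| < harmonic k /\ ~ P k z.
  by exists z.
apply: contrapT => nz; apply: (nP k).
apply/nbhs_ballP; exists (harmonic k); first exact: harmonic_gt0.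
move=> z; rewrite -ball_normE /ball_/= distrC => zk.
by apply: contrapT => nPz; apply: nz; exists z.
Qed.

Lemma near_closed_ball (R : realType) (V : normedModType R) (T : Type)
    (F : set_system T) (u : T -> V) (a : V) (rho : R) : Filter F ->
  u @ F --> a -> 0 < rho ->
  \forall k \near F, \forall v \near u k, `|v - a| <= rho.
Proof.
move=> FF ua rho0.
have : \forall k \near F, `|u k - a| < rho by exact: cvgr_distC_lt.
apply: filterS => k uk; apply/nbhs_ballP; exists (rho - `|u k - a|).
  by rewrite /= subr_gt0.
move=> v; rewrite -ball_normE /ball_/= distrC => vu.
by rewrite -(subrKA (u k)) (le_trans (ler_normD _ _))//; lra.
Qed.

(** * Ultrafilters in place of subsequences *)

(** Along an ultrafilter on [nat] finer than [\oo], every bounded sequence of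
    vectors converges and a sequence with values in a finite set is eventually
    constant.  Both replace the extraction of subsequences, so that all limits
    of an argument are taken along one and the same filter. *)
Section UltrafilterLimits.
Context {R : realType}.

Lemma ultrafilter_oo : exists2 U : set_system nat, UltraFilter U & \oo `<=` U.
Proof. by have [U [? ?]] := ultraFilterLemma eventually_filter; exists U. Qed.

Lemma cvg_finer (T : topologicalType) (U : set_system nat)
    (u : nat -> T) (a : T) :
  \oo `<=` U -> u @ \oo --> a -> u @ U --> a.
Proof. by move=> Uoo; apply: cvg_trans => B; exact: Uoo. Qed.

Lemma ultra_fmap (S T : Type) (f : S -> T) (U : set_system S) :
  UltraFilter U -> UltraFilter (f @ U).
Proof.
move=> UU; split; first exact: fmap_proper_filter.
move=> G GF UG; apply/seteqP; split=> // A GA.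
have [//|UnA] := in_ultra_setVsetC (f @^-1` A) UU.
have /filter_ex[x []//] : G (A `&` ~` A) by apply: filterI GA (UG _ _).
Qed.

Lemma ultra_pick (T : Type) (U : set_system T) (I : finType)
    (P : I -> T -> Prop) :
  UltraFilter U -> (forall k, exists i, P i k) -> exists i, U (P i).
Proof.
move=> UU Pe; apply: contrapT => /forallNP nP.
have : U (fun k => forall i, ~ P i k).
  apply: filter_forall => i.
  by have [//|] := in_ultra_setVsetC (P i) UU; have := nP i.
by move=> /filter_ex[k kP]; have [i /kP] := Pe k.
Qed.

Lemma ultra_bounded_cvg (T : Type) (U : set_system T) (p : nat)
    (u : T -> 'rV[R]_p) (M : R) :
  UltraFilter U -> U (fun k => `|u k| <= M) -> exists a : 'rV[R]_p, u @ U --> a.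
Proof.
move=> UU uM.
have : compact [set x : 'rV[R]_p | `|x| <= M].
  apply: bounded_closed_compact.
    by exists M; split; [exact: num_real|move=> e Me x /= /le_trans; apply; exact: ltW].
  rewrite -[[set _ | _]]/((fun x : 'rV[R]_p => `|x|) @^-1` [set y | y <= M]).
  by apply: closed_comp => [x _|]; [exact: norm_continuous|exact: closed_le].
rewrite compact_ultra => /(_ _ (ultra_fmap u UU) uM)[a [_ ua]].
by exists a.
Qed.

Lemma ultra_ball_cvg (T : Type) (U : set_system T) (p : nat)
    (u : T -> 'rV[R]_p) (b : 'rV[R]_p) (rho : R) :
  UltraFilter U -> (forall k, `|u k - b| <= rho) ->
  exists2 a : 'rV[R]_p, u @ U --> a & `|a - b| <= rho.
Proof.
move=> UU ub.
have [a ua] : exists a : 'rV[R]_p, u @ U --> a.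
  apply: (@ultra_bounded_cvg _ _ _ _ (rho + `|b|) UU); apply: nearW => k.
  by rewrite -{1}(subrK b (u k)) (le_trans (ler_normD _ _))// lerD2r.
exists a => //.
have uba : (fun k => u k - b) @ U --> a - b.
  by apply: cvgB => //; exact: cvg_cst.
by apply: (cvgr_to_le (cvg_norm uba)); exact: nearW.
Qed.

Lemma ultra_bounded_cvg_real (T : Type) (U : set_system T)
    (u : T -> R) (M : R) :
  UltraFilter U -> (forall k, `|u k| <= M) -> exists a : R, u @ U --> a.
Proof.
move=> UU uM.
have [a ac] : exists a : 'rV[R]_1, (fun k => \row_(i < 1) u k) @ U --> a.
  apply: (@ultra_bounded_cvg _ _ _ _ M UU); apply: nearW => k.
  rewrite [leLHS]/Num.Def.normr/= mx_normrE.
  by apply: bigmax_le => [|i _]; rewrite ?mxE// (le_trans _ (uM k)).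
exists (a 0 0); have FU : Filter U by exact: _.
have := (@cvg_mxP R T U FU _ _ _ _).1 ac 0 0.
by under eq_fun do rewrite mxE.
Qed.

End UltrafilterLimits.

(** * Farkas' lemma *)
Section Farkas.
Context {R : realType} {n : nat}.
Implicit Types (w eta x : 'rV[R]_n).

(** Bartl's induction on the number of inequalities.  If dropping the first
    one, [b ord0], breaks the implication, some [x] satisfies the others with
    [dot eta x > 0], hence [dot (b ord0) x > 0].  Projecting along [x] onto the
    kernel of [b ord0] leaves a problem with one inequality less, and [x] itself
    shows that the multiplier recovered for [b ord0] is nonnegative. *)
Lemma farkas (k : nat) (b : 'I_k -> 'rV[R]_n) eta :
  (forall w, (forall j, dot (b j) w <= 0) -> dot eta w <= 0) ->
  exists2 c : 'I_k -> R, (forall j, 0 <= c j) & eta = \sum_j c j *: b j.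
Proof.
elim: k => [|k IH] in b eta *.
  move=> /(_ eta) eta0; exists (fun=> 0) => //; rewrite big_ord0; apply/eqP.
  by rewrite -dot_eq0 eq_le dot_ge0 eta0// => -[].
move=> bE; pose b' j := b (lift ord0 j).
have [b'E|/existsNP[x /not_implyP[bx /negP]]] :=
    pselect (forall w, (forall j, dot (b' j) w <= 0) -> dot eta w <= 0).
  have [c c0 ->] := IH _ _ b'E.
  exists (fun j => if unlift ord0 j is Some i then c i else 0).
    by move=> j; case: unliftP.
  rewrite big_ord_recl unlift_none scale0r add0r.
  by apply: eq_bigr => j _; rewrite liftK.
rewrite -ltNge => etax.
have b0x : 0 < dot (b ord0) x.
  rewrite ltNge; apply/negP => b0x; move: etax; rewrite ltNge => /negP; apply.
  by apply: bE => j; case: (unliftP ord0 j) => [i ->|->//]; exact: bx.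
pose pr v := v - (dot v x / dot (b ord0) x) *: b ord0.
have [w|c c0 cE] := IH (fun j => pr (b' j)) (pr eta).
  move=> prw; pose w' := w - (dot (b ord0) w / dot (b ord0) x) *: x.
  have prE v : dot (pr v) w = dot v w'.
    rewrite /pr /w' dotBl dotBr dotZl dotZr.
    by ring.
  rewrite prE; apply: bE => j; case: (unliftP ord0 j) => [i ->|->].
    by rewrite -prE; exact: prw.
  by rewrite /w' dotBr dotZr divfK ?gt_eqF// subrr.
exists (fun j => if unlift ord0 j is Some i then c i
  else (dot eta x - \sum_i c i * dot (b' i) x) / dot (b ord0) x).
  move=> j; case: unliftP => // _; rewrite divr_ge0 ?(ltW b0x)// subr_ge0.
  rewrite (le_trans _ (ltW etax))// sumr_le0// => i _.
  by rewrite mulr_ge0_le0.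
rewrite big_ord_recl unlift_none.
rewrite [X in _ + X](eq_bigr (fun i => c i *: b' i)); last first.
  by move=> i _; rewrite liftK.
have etaE : eta = pr eta + (dot eta x / dot (b ord0) x) *: b ord0.
  by rewrite subrK.
rewrite {1}etaE cE mulrBl scalerBl addrC [RHS]addrAC -addrA; congr (_ + _).
rewrite mulr_suml scaler_suml -sumrB; apply: eq_bigr => i _.
by rewrite scalerBr scalerA mulrA.
Qed.

End Farkas.

(** * Subderivatives and tangent directions in epsilon form *)
Section LowerLimits.
Context {R : realType} {X : topologicalType}.
Variables (F : set_system X).
Implicit Types (h : X -> \bar R) (c : R).

Lemma limf_einf_leP h c :
  (limf_einf h F <= c%:E)%E <->
  forall A, F A -> forall e, 0 < e -> exists2 p, A p & (h p <= (c + e)%:E)%E.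
Proof.
rewrite limf_einfE; split=> [hc A FA e e0|hc].
  have : (ereal_inf (h @` A) < (c + e)%:E)%E.
    apply: le_lt_trans (_ : c%:E < _)%E; last by rewrite lte_fin ltrDl.
    by apply: le_trans hc; apply: ereal_sup_ubound; exists A.
  by move=> /ereal_inf_lt[_ [p Ap <-] /ltW]; exists p.
apply: ge_ereal_sup => _ [A FA <-]; apply/lee_addgt0Pr => e e0.
have [p Ap hp] := hc A FA e e0; rewrite -EFinD; apply: le_trans hp.
by apply: ereal_inf_lbound; exists p.
Qed.

Lemma limf_einf_ge h c :
  (forall e, 0 < e -> F [set p | ((c - e)%:E <= h p)%E]) ->
  (c%:E <= limf_einf h F)%E.
Proof.
move=> hc; rewrite limf_einfE; apply/lee_subgt0Pr => e e0.
apply: le_trans (_ : ereal_inf (h @` [set p | ((c - e)%:E <= h p)%E]) <= _)%E.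
  by apply: le_ereal_inf_tmp => _ [p /= hp <-].
by apply: ereal_sup_ubound; exists [set p | ((c - e)%:E <= h p)%E]; [exact: hc|].
Qed.

End LowerLimits.

Lemma filter_prod_right0P (R : realType) (V : normedModType R) (w : V)
    (A : set (R * V)) :
  filter_prod 0^'+ (nbhs w) A <->
  exists2 e : R, 0 < e & forall t v, 0 < t < e -> `|v - w| < e -> A (t, v).
Proof.
split=> [[[B C] /= [[e /= e0 eB] /nbhs_ballP[d /= d0 dC]] BCA]|[e e0 eA]].
  exists (Num.min e d); first by rewrite lt_min e0.
  move=> t v /andP[t0]; rewrite !lt_min => /andP[te _] /andP[_ vd].
  apply: BCA; split=> /=.
    by apply: eB => //; rewrite /ball_/= sub0r normrN gtr0_norm.
  by apply: dC; rewrite -ball_normE /ball_/= distrC.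
exists ([set t | 0 < t < e], ball w e) => /=; last first.
  move=> [t v] /= [te wv]; apply: eA => //.
  by move: wv; rewrite -ball_normE /ball_/= distrC.
split; last exact: nbhsx_ballx.
exists e => //= t; rewrite /ball_/= sub0r normrN => te t0.
by rewrite t0 (le_lt_trans (ler_norm _)).
Qed.

Section ConvexSubgradients.
Context {R : realType} {m : nat} (theta : 'rV[R]_m -> \bar R).
Hypothesis theta_gtNy : forall y, (-oo < theta y)%E.
Implicit Types (y z u v w l : 'rV[R]_m).

Lemma edomE y : edom theta y -> theta y = (fine (theta y))%:E.
Proof.
by move=> ty; rewrite fineK// fin_numE gt_eqF//= lt_eqF.
Qed.

Lemma edom_le y (c : R) : (theta y <= c%:E)%E -> edom theta y.
Proof. by move=> /le_lt_trans; apply; rewrite ltry. Qed.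

Lemma le_fine y (c : R) : (theta y <= c%:E)%E -> fine (theta y) <= c.
Proof. by move=> yc; rewrite -lee_fin -edomE//; exact: edom_le yc. Qed.

Lemma subdifferentialP y l :
  subdifferential theta y l <-> edom theta y /\
    forall z, edom theta z -> fine (theta y) + dot l (z - y) <= fine (theta z).
Proof.
split=> -[ty lP]; split=> // z.
  by move=> tz; have := lP z; rewrite (edomE ty) (edomE tz) -EFinD lee_fin.
have [tz|] := pselect (edom theta z).
  by rewrite (edomE ty) (edomE tz) -EFinD lee_fin lP.
by move=> /negP; rewrite -leNgt leye_eq => /eqP ->; rewrite leey.
Qed.

(** [low_curvature y u w c] is the inequality [d^2 theta (y, u) (w) <= c] with
    the lower limit unfolded.  It is phrased with real numbers only, which is
    possible because a finite upper bound forces the points [y + t *: v] into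
    the domain. *)
Definition low_curvature y u w (c : R) : Prop :=
  forall e, 0 < e -> exists t v, [/\ 0 < t < e, `|v - w| < e,
    edom theta (y + t *: v) &
    fine (theta (y + t *: v)) <=
      fine (theta y) + t * dot u v + 2^-1 * t ^+ 2 * (c + e)].

Lemma second_subderivative_leP y u w c : edom theta y ->
  (second_subderivative theta y u w <= c%:E)%E <-> low_curvature y u w c.
Proof.
move=> ty.
have quotP t v d : 0 < t ->
    (((theta (y + t *: v)%R - theta y - (t * dot u v)%R%:E)
       * ((2^-1 * t ^+ 2)^-1)%R%:E) <= d%:E)%E <->
    edom theta (y + t *: v) /\ fine (theta (y + t *: v)) <=
      fine (theta y) + t * dot u v + 2^-1 * t ^+ 2 * d.
  move=> t0; have t20 : 0 < 2^-1 * t ^+ 2 by rewrite mulr_gt0 ?invr_gt0 ?exprn_gt0.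
  have [tv|tv] := pselect (edom theta (y + t *: v)).
    rewrite (edomE ty) (edomE tv) -!EFinB -EFinM lee_fin/= ler_pdivrMr//.
    by split=> [dP|[_ dP]]; [split=> //|]; lra.
  split=> [|[]//]; rewrite (edomE ty).
  have -> : theta (y + t *: v) = +oo%E.
    by apply/eqP; rewrite -leye_eq leNgt; apply/negP.
  by rewrite !addye// mulyr gtr0_sg ?invr_gt0// mul1e leye_eq.
split=> [/limf_einf_leP d2|d2].
  move=> e e0.
  have [|[t v] /= [te ve] /quotP[]] := d2
    [set p : R * 'rV_m | 0 < p.1 < e /\ `|p.2 - w| < e] _ _ e0.
  - by apply/filter_prod_right0P; exists e.
  - by case/andP: te.
  by move=> tv tvP; exists t, v.
apply/limf_einf_leP => A /filter_prod_right0P[a a0 aA] e e0.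
have ea0 : 0 < Num.min e a by rewrite lt_min e0.
have [t [v [/andP[t0]]]] := d2 _ ea0.
rewrite !lt_min => /andP[te ta] /andP[ve va] tv tvP.
exists (t, v) => /=; first by apply: aA; rewrite ?t0.
apply/quotP => //; split=> //; apply: le_trans tvP _.
rewrite lerD2l ler_pM2l; first by rewrite lerD2l ge_min lexx.
by rewrite mulr_gt0 ?invr_gt0 ?exprn_gt0.
Qed.

Lemma low_curvature_seq y u w c : low_curvature y u w c ->
  exists (t : R^nat) (v : ('rV[R]_m)^nat),
  [/\ forall k, 0 < t k, t @ \oo --> (0 : R), v @ \oo --> w,
    forall k, edom theta (y + t k *: v k) &
    forall k, fine (theta (y + t k *: v k)) <=
      fine (theta y) + t k * dot u (v k) + 2^-1 * t k ^+ 2 * (c + harmonic k)].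
Proof.
move=> d2.
have /choice[tv tvP] k : exists p : R * 'rV[R]_m, [/\ 0 < p.1 < harmonic k,
    `|p.2 - w| < harmonic k, edom theta (y + p.1 *: p.2) &
    fine (theta (y + p.1 *: p.2)) <=
      fine (theta y) + p.1 * dot u p.2 + 2^-1 * p.1 ^+ 2 * (c + harmonic k)].
  by have [t [v tvP]] := d2 _ (harmonic_gt0 k); exists (t, v).
exists (fun k => (tv k).1), (fun k => (tv k).2); split=> [k|||k|k].
- by have [/andP[]] := tvP k.
- apply: cvg_dist_harmonic => k; rewrite subr0.
  by have [/andP[t0 /ltW tk] _ _ _] := tvP k; rewrite gtr0_norm.
- by apply: cvg_dist_harmonic => k; have [_ /ltW] := tvP k.
- by have [] := tvP k.
- by have [] := tvP k.
Qed.

(** The second-order condition is required only on the critical cone, but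
    outside of it the second subderivative of a convex function at a subgradient
    is infinite: a bound on the second-order quotients makes the first-order
    ones converge to [dot u w], and the subgradient inequality gives the reverse
    estimate. *)
Lemma low_curvature_critical y u w c :
  subdifferential theta y u -> low_curvature y u w c ->
  critical_cone theta y u w.
Proof.
move=> /subdifferentialP[ty uP] d2; apply/eqP; rewrite eq_le; apply/andP; split.
  apply/limf_einf_leP => A /filter_prod_right0P[a a0 aA] e e0.
  have [t [v [t0 tcvg vcvg tv tvP]]] := low_curvature_seq d2.
  have lim : (fun k => dot u (v k) + 2^-1 * t k * (c + harmonic k)) @ \oo -->
      dot u w + 2^-1 * 0 * (c + 0).
    apply: cvgD; first exact: cvg_dot (cvg_cst _) vcvg.
    apply: cvgM; first exact: cvgM (cvg_cst _) tcvg.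
    by apply: cvgD; [exact: cvg_cst|exact: cvg_harmonic].
  have [k [] ] : exists k, [/\ t k < a, `|v k - w| < a &
      dot u (v k) + 2^-1 * t k * (c + harmonic k) <= dot u w + e].
    near \oo => k; exists k; split; near: k.
    - exact: (cvgr_lt (0 : R)).
    - exact: cvgr_distC_lt.
    - by apply: cvgr_le lim _ _; rewrite mulr0 mul0r addr0 ltrDl.
  move=> ta va ke; exists (t k, v k) => /=; first by apply: aA; rewrite ?t0.
  rewrite (edomE ty) (edomE (tv k)) -EFinB -EFinM lee_fin/= ler_pdivrMr//.
  have := tvP k; have := ler_wpM2l (ltW (t0 k)) ke; lra.
apply: limf_einf_ge => e e0; apply/filter_prod_right0P.
move/cvgrPdist_lt: (@dot_continuous _ _ u w) => /(_ e e0)/nbhs_ballP[d /= d0 dP].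
exists d => // t v /andP[t0 td] vd.
rewrite /=; have [tv|] := pselect (edom theta (y + t *: v)); last first.
  move=> tv; have -> : theta (y + t *: v) = +oo%E.
    by apply/eqP; rewrite -leye_eq leNgt; apply/negP.
  by rewrite (edomE ty) addye// mulyr gtr0_sg ?invr_gt0// mul1e leey.
rewrite (edomE ty) (edomE tv) -EFinB -EFinM lee_fin/= ler_pdivlMr//.
have := uP _ tv; rewrite addrAC subrr add0r dotZr.
have : `|dot u w - dot u v| < e.
  by apply: dP; rewrite -ball_normE /ball_/= distrC.
rewrite ltr_norml => /andP[_ ue].
have : (dot u w - e) * t <= dot u v * t by rewrite ler_pM2r//; lra.
by lra.
Unshelve. all: by end_near. Qed.

End ConvexSubgradients.

Section TangentDirections.
Context {R : realType} {V : normedModType R}.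

Lemma tangent_coneP (Omega : set V) x w :
  tangent_cone Omega x w <-> forall e, 0 < e ->
    exists t u, [/\ 0 < t < e, `|u - w| < e & Omega (x + t *: u)].
Proof.
split=> [[t [u [t0 tcvg ucvg tu]]] e e0|xw].
  near \oo => k; exists (t k), (u k); split=> //; last near: k.
    by rewrite t0/=; near: k; exact: (cvgr_lt (0 : R)).
  exact: cvgr_distC_lt.
have /choice[tu tuP] k : exists p : R * V, [/\ 0 < p.1 < harmonic k,
    `|p.2 - w| < harmonic k & Omega (x + p.1 *: p.2)].
  by have [t [v tvP]] := xw _ (harmonic_gt0 k); exists (t, v).
exists (fun k => (tu k).1), (fun k => (tu k).2); split=> [k|||k].
- by have [/andP[]] := tuP k.
- apply: cvg_dist_harmonic => k; rewrite subr0.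
  by have [/andP[t0 /ltW tk] _ _] := tuP k; rewrite gtr0_norm.
- by apply: cvg_dist_harmonic => k; have [_ /ltW] := tuP k.
- by have [] := tuP k.
Unshelve. all: by end_near. Qed.

End TangentDirections.

(** The restriction to critical directions and the extended-real arithmetic of
    the second-order condition disappear together: it fails at [w] exactly when
    the second subderivative is bounded by the negated Hessian term. *)
Lemma SOSC_low_curvatureP (R : realType) (n m : nat)
    (phi0 : 'rV[R]_n -> R) (f : 'rV[R]_n -> 'rV[R]_m)
    (theta : 'rV[R]_m -> \bar R) (x : 'rV[R]_n) (l : 'rV[R]_m) :
  (forall y, (-oo < theta y)%E) -> subdifferential theta (f x) l ->
  SOSC phi0 f theta x l <-> forall w, w != 0 ->
    ~ low_curvature theta (f x) l (w *m 'J f x)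
        (- dot (w *m hess_lagrangian phi0 f x l) w).
Proof.
move=> tNy lP; have [fx _] := lP; split=> soc w w0.
  move=> d2; have := soc w w0 (low_curvature_critical tNy lP d2).
  move/(second_subderivative_leP tNy _ _ _ fx): d2.
  by rewrite EFinN ltNge -leeBrDr// sub0e => ->.
move=> _; rewrite ltNge; apply/negP; rewrite -leeBrDr// sub0e -EFinN.
by move=> /(second_subderivative_leP tNy _ _ _ fx); exact: soc.
Qed.

(** * Strong metric subregularity *)
Section StrongSubregularity.
Context {R : realType} {n m : nat}.
Implicit Types (z s : 'rV[R]_n * 'rV[R]_m).

Definition sqnorm z : R := dot z.1 z.1 + dot z.2 z.2.

Lemma sqnorm_ge0 z : 0 <= sqnorm z.
Proof. by rewrite addr_ge0 ?dot_ge0. Qed.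

Lemma prod_enormE z : prod_enorm z = Num.sqrt (sqnorm z).
Proof. by rewrite /prod_enorm /enorm !sqr_sqrtr ?dot_ge0. Qed.

Lemma sqnormN z : sqnorm (- z) = sqnorm z.
Proof. by rewrite /sqnorm !dotE !opprK. Qed.

(** Squaring the Euclidean norms turns the distance estimate into a polynomial
    inequality in the coordinates, for each element of the image set. *)
Lemma strongly_subregularP
    (S : 'rV[R]_n * 'rV[R]_m -> set ('rV[R]_n * 'rV[R]_m)) zbar :
  strongly_metrically_subregular (@prod_enorm R n m) (@prod_enorm R n m)
    S zbar (0, 0) <->
  S zbar (0, 0) /\ exists2 K : R, 0 <= K &
    \forall z \near zbar, forall s, S z s -> sqnorm (z - zbar) <= K * sqnorm s.
Proof.
have sub0 z : (0, 0) - z = - z by rewrite -[(0, 0)]/(0 : 'rV[R]_n * 'rV[R]_m) sub0r.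
split=> -[Sz [k k0 kP]]; split=> //.
  exists (k ^+ 2); first exact: sqr_ge0.
  apply: filterS kP => z zP s Szs.
  have : ((prod_enorm (z - zbar))%:E <= k%:E * (prod_enorm s)%:E)%E.
    apply: le_trans zP _; apply: lee_wpmul2l; first by rewrite lee_fin.
    by apply: ereal_inf_lbound; exists s => //; rewrite sub0 !prod_enormE sqnormN.
  rewrite -EFinM lee_fin !prod_enormE => sP.
  rewrite -[leLHS]sqr_sqrtr ?sqnorm_ge0// -[in leRHS](sqr_sqrtr (sqnorm_ge0 s)).
  by rewrite -exprMn ler_pXn2r ?nnegrE ?mulr_ge0 ?sqrtr_ge0.
(* The constant must be positive, since 0 * +oo = 0 while an empty image has
   distance +oo *)
exists (Num.sqrt k + 1); first by rewrite addr_ge0.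
have k10 : 0 < Num.sqrt k + 1 by rewrite ltr_wpDl.
apply: filterS kP => z zP; rewrite muleC -lee_pdivrMr//.
apply: le_ereal_inf_tmp => _ [s Szs <-].
rewrite sub0 !prod_enormE sqnormN -EFinM lee_fin ler_pdivrMr// mulrC.
apply: (@le_trans _ _ (Num.sqrt k * Num.sqrt (sqnorm s))).
  by rewrite -sqrtrM// ler_sqrt ?mulr_ge0 ?sqnorm_ge0// zP.
by rewrite ler_wpM2r ?sqrtr_ge0// lerDl.
Qed.

End StrongSubregularity.

(** * Polyhedra and quadratic functions *)

(** The way a term of second order in the step length is discarded. *)
Lemma le_first_order (R : realType) (x y z : R) :
  (\forall s \near 0^'+, x <= y + s * z) -> x <= y.
Proof.
move=> xyz; apply: cvgr_to_ge xyz.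
rewrite -[X in _ --> X]addr0 -[X in _ --> _ + X](mul0r z).
apply: cvgD; first exact: cvg_cst.
apply: cvgM; last exact: cvg_cst.
exact: cvg_within.
Qed.

Section Polyhedra.
Context {R : realType} {m : nat}.
Implicit Types (y z w : 'rV[R]_m) (Omega : set 'rV[R]_m).

Definition feasible_direction Omega y : set 'rV[R]_m :=
  [set w | \forall t \near 0^'+, Omega (y + t *: w)].

Lemma polyhedral_closed Omega : polyhedral Omega -> closed Omega.
Proof.
move=> [k [b [beta ->]]].
have -> : [set y | forall j, dot (b j) y <= beta j] =
    \bigcap_j ((fun y => dot (b j) y) @^-1` [set c | c <= beta j]).
  by apply/seteqP; split=> [y yb j _|y yb j]; exact: yb.
apply: closed_bigI => j _; apply: closed_comp; last exact: closed_le.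
by move=> y _; exact: dot_continuous.
Qed.

Lemma polyhedral_segment Omega y z t : polyhedral Omega ->
  Omega y -> Omega z -> 0 <= t -> t <= 1 -> Omega (y + t *: (z - y)).
Proof.
move=> [k [b [beta ->]]] yb zb t0 t1 j /=.
have := ler_wpM2l t0 (zb j).
have t1' : 0 <= 1 - t by lra.
have := ler_wpM2l t1' (yb j).
by rewrite dotDr dotZr dotBr; lra.
Qed.

(** For a polyhedron the cone of feasible directions is cut out by the active
    constraints.  In particular it is closed, hence contains the limits of the
    directions towards points of the polyhedron: a tangent direction is
    feasible for small steps, which is false for general convex sets. *)
Lemma feasible_directionP (k : nat) (b : 'I_k -> 'rV[R]_m)
    (beta : 'I_k -> R) y w :
  (forall j, dot (b j) y <= beta j) ->
  feasible_direction [set y | forall j, dot (b j) y <= beta j] y w <->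
  forall j, dot (b j) y = beta j -> dot (b j) w <= 0.
Proof.
move=> yb; split=> [yw j yj|wb].
  have : \forall t \near 0^'+, 0 < t /\ dot (b j) (y + t *: w) <= beta j.
    by apply: filterS2 (nbhs_right_gt 0) yw => t t0 /(_ j).
  move=> /filter_ex[t [t0]].
  by rewrite dotDr dotZr yj gerDl pmulr_rle0.
rewrite /feasible_direction /=; apply: filter_forall => j.
have [yj|yj] := eqVneq (dot (b j) y) (beta j).
  apply: filterS (nbhs_right_gt 0) => t t0.
  by rewrite dotDr dotZr yj gerDl pmulr_rle0// wb.
have ltj : dot (b j) y < beta j by rewrite lt_neqAle yj yb.
have lim : (fun t => dot (b j) (y + t *: w)) @ 0^'+ --> dot (b j) y.
  apply: cvg_dot; first exact: cvg_cst.
  by apply: cvg_add_scale; [exact: cvg_within|exact: cvg_cst].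
exact: cvgr_le lim _ _.
Qed.

Lemma feasible_direction_closed Omega y :
  polyhedral Omega -> Omega y -> closed (feasible_direction Omega y).
Proof.
move=> [k [b [beta ->]]] yb.
have -> : feasible_direction [set y | forall j, dot (b j) y <= beta j] y =
    \bigcap_(j in [set j | dot (b j) y = beta j])
      (dot (b j) @^-1` [set c | c <= 0]).
  apply/seteqP; split=> [w /(feasible_directionP _ yb) wb j|w wb]; first exact: wb.
  by apply/(feasible_directionP _ yb).
apply: closed_bigI => j _; apply: closed_comp; last exact: closed_le.
by move=> w _; exact: dot_continuous.
Qed.

Lemma feasible_direction_segment Omega y w t : polyhedral Omega ->
  Omega y -> 0 < t -> Omega (y + t *: w) -> feasible_direction Omega y w.
Proof.
move=> pO Oy t0 Ot; rewrite /feasible_direction/=.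
apply: filterS2 (nbhs_right_gt 0) (nbhs_right_le t0) => s s0 st.
have -> : y + s *: w = y + (s / t) *: ((y + t *: w) - y).
  by rewrite addrAC subrr add0r scalerA divfK ?gt_eqF.
apply: polyhedral_segment => //; first by rewrite divr_ge0// ltW.
by rewrite ler_pdivrMr// mul1r.
Qed.

End Polyhedra.

Section Quadratic.
Context {R : realType} {m : nat}.
Implicit Types (A : 'M[R]_m) (a y d : 'rV[R]_m).

Definition quadratic A a (alpha : R) y : R :=
  2^-1 * dot (y *m A) y + dot a y + alpha.

Lemma quadraticD A a alpha y d (s : R) : A^T = A ->
  quadratic A a alpha (y + s *: d) = quadratic A a alpha y +
    s * dot (y *m A + a) d + s ^+ 2 * (2^-1 * dot (d *m A) d).
Proof.
move=> sA; rewrite /quadratic mulmxDl -scalemxAl !dotE.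
have -> : dot (d *m A) y = dot (y *m A) d by rewrite dot_mulmx sA dotC.
by field.
Qed.

Lemma cvg_quadratic A a alpha (T : Type) (F : set_system T) (y : T -> 'rV[R]_m)
    (ybar : 'rV[R]_m) : Filter F ->
  y @ F --> ybar ->
  (fun k => quadratic A a alpha (y k)) @ F --> quadratic A a alpha ybar.
Proof.
move=> FF yP; apply: cvgD; last exact: cvg_cst.
apply: cvgD; last by apply: cvg_dot => //; exact: cvg_cst.
apply: cvgM; first exact: cvg_cst.
by apply: cvg_dot => //; apply: cvg_mulmx => //; exact: cvg_cst.
Qed.

End Quadratic.

(** * Convex piecewise linear-quadratic functions *)
Lemma graphical_derivative_seq (R : realType) (V W : normedModType R)
    (S : V -> set W) x y u v :
  graphical_derivative S x y u v ->
  exists (t : R^nat) (a : V^nat) (b : W^nat),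
  [/\ forall k, 0 < t k, t @ \oo --> (0 : R), a @ \oo --> u, b @ \oo --> v
    & forall k, S (x + t k *: a k) (y + t k *: b k)].
Proof.
move=> [t [p [t0 tc pc pS]]].
exists t, (fun k => (p k).1), (fun k => (p k).2); split=> //.
  by apply: cvg_comp pc _; exact: cvg_fst.
by apply: cvg_comp pc _; exact: cvg_snd.
Qed.

Section PiecewiseLinearQuadratic.
Context {R : realType} {m : nat} {theta : 'rV[R]_m -> \bar R}.
Hypothesis theta_gtNy : forall y, (-oo < theta y)%E.
Hypothesis theta_convex : convex_efun theta.
Context {s : nat} {Omega : 'I_s -> set 'rV[R]_m} {A : 'I_s -> 'M[R]_m}
  {a : 'I_s -> 'rV[R]_m} {alpha : 'I_s -> R}.
Hypothesis Omega_poly : forall i, polyhedral (Omega i).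
Hypothesis A_sym : forall i, (A i)^T = A i.
Hypothesis edom_theta : edom theta = \bigcup_i Omega i.
Hypothesis theta_piece : forall i y, Omega i y ->
  theta y = (2^-1 * dot (y *m A i) y + dot (a i) y + alpha i)%:E.
Implicit Types (y z u v w l eta : 'rV[R]_m) (i : 'I_s).

Let theta_gtNyP := edomE theta_gtNy.

Lemma piece_edom i y : Omega i y -> edom theta y.
Proof. by rewrite edom_theta; exists i. Qed.

Lemma edom_piece y : edom theta y -> exists i, Omega i y.
Proof. by rewrite edom_theta => -[i _ Oy]; exists i. Qed.

Lemma fine_piece i y :
  Omega i y -> fine (theta y) = quadratic (A i) (a i) (alpha i) y.
Proof. by move=> /theta_piece ->. Qed.

(** Along an ultrafilter the sequence stays in one piece, which is closed and
    on which the function is a polynomial.  So the domain is closed and the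
    function is continuous along sequences in its domain. *)
Lemma ultra_lim_plq (T : Type) (U : set_system T) (y : T -> 'rV[R]_m)
    (ybar : 'rV[R]_m) :
  UltraFilter U -> (forall k, edom theta (y k)) -> y @ U --> ybar ->
  edom theta ybar /\ (fun k => fine (theta (y k))) @ U --> fine (theta ybar).
Proof.
move=> UU yd yP.
have [i Ui] := ultra_pick UU (fun k => edom_piece (yd k)).
have Oi : Omega i ybar.
  by exact: (closed_cvg _ (polyhedral_closed (Omega_poly i))
    Ui _ yP).
split; first exact: piece_edom Oi.
rewrite (fine_piece Oi).
have lim : (fun k => quadratic (A i) (a i) (alpha i) (y k)) @ U -->
    quadratic (A i) (a i) (alpha i) ybar by exact: cvg_quadratic.
apply: cvg_trans lim; apply: near_eq_cvg; apply: filterS Ui => k /= Oik.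
by rewrite (fine_piece Oik).
Qed.

Lemma convex_fine y z t : edom theta y -> edom theta z -> 0 < t -> t < 1 ->
  edom theta (y + t *: (z - y)) /\
  fine (theta (y + t *: (z - y))) <= (1 - t) * fine (theta y) + t * fine (theta z).
Proof.
move=> ty tz t0 t1.
have -> : y + t *: (z - y) = t *: z + (1 - t) *: y.
  by rewrite scalerBr scalerBl scale1r addrCA.
have := theta_convex z y t0 t1.
rewrite (theta_gtNyP ty) (theta_gtNyP tz) -!EFinM -EFinD => tP.
split; first exact: edom_le tP.
by have := le_fine theta_gtNy tP; lra.
Qed.

Lemma subgradient_piece i y w l : Omega i y -> feasible_direction (Omega i) y w ->
  subdifferential theta y l -> dot l w <= dot (y *m A i + a i) w.
Proof.
move=> Oy yw /(subdifferentialP theta_gtNy)[ty lP].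
apply: (@le_first_order _ _ _ (2^-1 * dot (w *m A i) w)).
apply: filterS2 (nbhs_right_gt 0) yw => t t0 Ot.
have := lP _ (piece_edom Ot).
rewrite (fine_piece Oy) (fine_piece Ot) quadraticD// [y + t *: w]addrC addrK dotZr.
by move=> lw; rewrite -(ler_pM2l t0); lra.
Qed.

(** Conversely, subgradients can be recognized on the pieces through [y].  The
    segment from [y] to a point of the domain has a sequence of points in one
    piece that converges to [y]; this piece contains [y], and convexity along
    the segment carries the first-order inequality to its far end. *)
Lemma pieces_subgradient y l : edom theta y ->
  (forall i w, Omega i y -> feasible_direction (Omega i) y w ->
     dot l w <= dot (y *m A i + a i) w) ->
  subdifferential theta y l.
Proof.
move=> ty lP; apply/(subdifferentialP theta_gtNy); split=> // z tz.
have [U UU Uoo] := ultrafilter_oo.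
pose t : nat -> R := fun k => (k.+2%:R)^-1.
have t0 k : 0 < t k by rewrite invr_gt0.
have t1 k : t k < 1 by rewrite invf_lt1 ?ltr1n.
have tcvg : t @ U --> (0 : R).
  by apply: cvg_finer => //; have := @cvg_harmonic R; rewrite -cvg_shiftS.
have [i Ui] := ultra_pick UU (fun k => edom_piece (convex_fine ty tz (t0 k) (t1 k)).1).
have lim : (fun k => y + t k *: (z - y)) @ U --> y.
  by apply: cvg_add_scale tcvg _; exact: cvg_cst.
have Oy : Omega i y.
  by exact: (closed_cvg _ (polyhedral_closed (Omega_poly i))
    Ui _ lim).
have [k0 Ok0] := filter_ex Ui.
have zy := feasible_direction_segment (Omega_poly i) Oy (t0 k0) Ok0.
have := lP i _ Oy zy; rewrite -lerBrDl => /le_trans; apply.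
apply: (@le_first_order _ _ _ (- (2^-1 * dot ((z - y) *m A i) (z - y)))).
apply: filterS3 (nbhs_right_gt 0) (nbhs_right_lt ltr01) zy => r r0 r1 Or.
have [_] := convex_fine ty tz r0 r1.
rewrite (fine_piece Or) quadraticD// -(fine_piece Oy) => zP.
rewrite -(ler_pM2l r0); lra.
Qed.

(** Let [lbar + t *: mu] be a subgradient at [ybar + t *: v], with [(v, mu)]
    converging to [(u, eta)] and the points in a piece with matrix [A] and vector
    [a].  The first-order inequalities at both ends of the segment,
    [dot lbar v <= dot (ybar *m A + a) v] and the reverse one at
    [ybar + t *: v], combine to [dot (v *m A) v <= dot mu v].  In the limit the
    linear term vanishes at [u], so that the second-order quotients along the
    fixed feasible direction [u] equal [dot (u *m A) u].  The convex
    inequalities between the two end points alone would lose a factor two. *)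
Lemma graphical_derivative_low_curvature ybar lbar u eta :
  subdifferential theta ybar lbar ->
  graphical_derivative (subdifferential theta) ybar lbar u eta ->
  low_curvature theta ybar lbar u (dot eta u).
Proof.
move=> lP /graphical_derivative_seq[t [v [mu [t0 toc voc muoc gP]]]].
have [U UU Uoo] := ultrafilter_oo.
have [tc vc muc] : [/\ t @ U --> (0 : R), v @ U --> u & mu @ U --> eta].
  by split; exact: cvg_finer.
have [i Ui] := ultra_pick UU (fun k => edom_piece (gP k).1).
have lim : (fun k => ybar + t k *: v k) @ U --> ybar by exact: cvg_add_scale tc vc.
have Oy : Omega i ybar.
  by exact: (closed_cvg _ (polyhedral_closed (Omega_poly i))
    Ui _ lim).
have vfeas : U (fun k => feasible_direction (Omega i) ybar (v k)).
  apply: filterS Ui => k; exact: feasible_direction_segment.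
have ufeas : feasible_direction (Omega i) ybar u.
  by exact: (closed_cvg _ (feasible_direction_closed (Omega_poly i) Oy) vfeas _ vc).
have key : U (fun k =>
    dot lbar (v k) <= dot (ybar *m A i + a i) (v k) /\
    dot (ybar *m A i + a i) (v k) + t k * dot (v k *m A i) (v k) <=
      dot lbar (v k) + t k * dot (mu k) (v k)).
  apply: filterS2 Ui vfeas => k Ok fk.
  split; first exact: subgradient_piece lP.
  have fk' : feasible_direction (Omega i) (ybar + t k *: v k) (- v k).
    apply: (feasible_direction_segment (Omega_poly i) Ok (t0 k)).
    by rewrite scalerN addrK.
  have := subgradient_piece Ok fk' (gP k).
  by rewrite !dotNr lerN2 mulmxDl -scalemxAl !dotE; lra.
have curv : dot (u *m A i) u <= dot eta u.
  apply: (@ler_cvg_to _ U _ _ (fun k => dot (v k *m A i) (v k))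
    (fun k => dot (mu k) (v k))).
  - by apply: cvg_dot => //; apply: cvg_mulmx => //; exact: cvg_cst.
  - exact: cvg_dot.
  - by apply: filterS key => k [k1 k2]; rewrite -(ler_pM2l (t0 k)); lra.
have psi : dot (ybar *m A i + a i) u <= dot lbar u.
  have -> : dot lbar u = dot lbar u + 0 * (dot eta u - dot (u *m A i) u).
    by rewrite mul0r addr0.
  apply: (@ler_cvg_to _ U _ _ (fun k => dot (ybar *m A i + a i) (v k))
    (fun k => dot lbar (v k) +
      t k * (dot (mu k) (v k) - dot (v k *m A i) (v k)))).
  - by apply: cvg_dot => //; exact: cvg_cst.
  - apply: cvgD; first by apply: cvg_dot => //; exact: cvg_cst.
    apply: cvgM => //; apply: cvgB; first exact: cvg_dot.
    by apply: cvg_dot => //; apply: cvg_mulmx => //; exact: cvg_cst.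
  - by apply: filterS key => k [k1 k2]; lra.
move=> e e0.
have : \forall r \near 0^'+, [/\ 0 < r, r < e & Omega i (ybar + r *: u)].
  by apply: filterS3 (nbhs_right_gt 0) (nbhs_right_lt e0) ufeas.
move=> /filter_ex[r [r0 re Or]]; exists r, u; split.
- by rewrite r0.
- by rewrite subrr normr0.
- exact: piece_edom Or.
rewrite (fine_piece Or) quadraticD// -(fine_piece Oy).
have := ler_wpM2l (ltW r0) psi.
have r20 : 0 <= r ^+ 2 by rewrite sqr_ge0.
have ce : dot (u *m A i) u <= dot eta u + e by lra.
have := ler_wpM2l r20 ce; lra.
Qed.

(** Polyhedrality of the graph of the subdifferential in the vertical
    direction.  Let [p w] be the excess of the directional derivative of the
    function over [dot lbar w], for [w] feasible in a piece through [ybar].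
    Testing the subgradients of the approximating points at [ybar + s *: w],
    with [s] proportional to [t], gives [dot eta w <= 0] whenever [p w <= 0].
    Farkas' lemma improves this to [dot eta w <= c * p w] on the whole cone of
    feasible directions, so [lbar + t *: eta] is a subgradient for small [t > 0]. *)
Lemma graphical_derivative0_subgradient ybar lbar eta :
  subdifferential theta ybar lbar ->
  graphical_derivative (subdifferential theta) ybar lbar 0 eta ->
  exists2 t, 0 < t & subdifferential theta ybar (lbar + t *: eta).
Proof.
move=> lP /graphical_derivative_seq[t [v [mu [t0 tc vc muc gP]]]].
have [ty lsub] := (subdifferentialP theta_gtNy _ _).1 lP.
have etaP i w : Omega i ybar -> feasible_direction (Omega i) ybar w ->
    dot (ybar *m A i + a i) w <= dot lbar w -> dot eta w <= 0.
  move=> Oy wf wl; apply: (@le_first_order _ _ _ (2^-1 * dot (w *m A i) w)).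
  apply: filterS (nbhs_right_gt 0) => r r0; rewrite add0r -(ler_pM2l r0) mulrA -expr2.
  have -> : r * dot eta w = dot eta (r *: w - 0) by rewrite subr0 dotZr.
  apply: (@ler_cvg_to _ \oo _ _ (fun k => dot (mu k) (r *: w - v k)) (fun=> _)).
  - apply: cvg_dot => //; apply: cvgB => //; exact: cvg_cst.
  - exact: cvg_cst.
  case: wf => e /= e0 eO.
  have tre : \forall k \near \oo, t k < e / r by apply: (cvgr_lt _ tc); rewrite divr_gt0.
  apply: filterS tre => k; rewrite ltr_pdivlMr// => tke.
  have Ok : Omega i (ybar + (t k * r) *: w).
    have tr0 : 0 < t k * r by rewrite mulr_gt0.
    by apply: eO => //=; rewrite sub0r normrN gtr0_norm.
  have [tk lk] := (subdifferentialP theta_gtNy _ _).1 (gP k).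
  have := lk _ (piece_edom Ok); rewrite (fine_piece Ok) quadraticD// -(fine_piece Oy).
  have := lsub _ tk.
  have -> : ybar + (t k * r) *: w - (ybar + t k *: v k) = t k *: (r *: w - v k).
    by rewrite opprD addrACA subrr add0r scalerBr scalerA.
  rewrite [ybar + t k *: v k]addrC addrK.
  have := ler_wpM2l (ltW (mulr_gt0 (t0 k) r0)) wl.
  rewrite -(ler_pM2l (mulr_gt0 (t0 k) (t0 k)) (dot _ _)) !dotE; lra.
have /choice[c cP] i : exists c, 0 <= c /\ (Omega i ybar ->
    forall w, feasible_direction (Omega i) ybar w ->
    dot eta w <= c * (dot (ybar *m A i + a i) w - dot lbar w)).
  have [Oy|nOy] := pselect (Omega i ybar); last by exists 0.
  have [k [b [beta OE]]] := Omega_poly i.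
  have yb : forall j, dot (b j) ybar <= beta j by move: Oy; rewrite OE.
  (* Farkas' lemma is applied to the active constraints and to the excess;
     inactive constraints are replaced by the zero vector, which keeps the
     index type *)
  pose b' (j : 'I_k.+1) := if unlift ord0 j is Some j' then
      if dot (b j') ybar == beta j' then b j' else 0
    else ybar *m A i + a i - lbar.
  have [w wb|c c0 etaE] := @farkas _ _ _ b' eta.
    apply: (etaP i) => //.
      rewrite OE; apply/(feasible_directionP _ yb) => j /eqP yj.
      by have := wb (lift ord0 j); rewrite /b' liftK yj.
    by have := wb ord0; rewrite /b' unlift_none dotBl subr_le0.
  exists (c ord0); split=> // _ w; rewrite OE => /(feasible_directionP _ yb) wf.
  rewrite etaE big_ord_recl dotDl dotZl -dotBl {1}/b' unlift_none gerDl.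
  elim/big_ind : _ => [|x y x0 y0|j _]; first by rewrite dot0l.
    by rewrite dotDl; lra.
  rewrite dotZl mulr_ge0_le0// /b' liftK.
  by case: eqP => [/wf//|_]; rewrite dot0l.
have c0 : 0 < 1 + \sum_i c i.
  by rewrite ltr_wpDr// sumr_ge0// => i _; have [] := cP i.
exists (1 + \sum_i c i)^-1; first by rewrite invr_gt0.
apply: pieces_subgradient => // i w Oy wf; rewrite dotDl dotZl.
have lw := subgradient_piece Oy wf lP.
have [ci /(_ Oy w wf) etaw] := cP i.
rewrite -lerBrDl mulrC ler_pdivrMr// mulrC; apply: le_trans etaw _.
rewrite ler_wpM2r ?subr_ge0// (bigD1 i)//= addrCA lerDl addr_ge0// sumr_ge0// => j _.
by have [] := cP j.
Qed.

End PiecewiseLinearQuadratic.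

(** * Differential calculus *)
Section DifferenceQuotients.
Context {R : realType}.

Lemma diff_eps (V W : normedModType R) (g : V -> W) x e :
  differentiable g x -> 0 < e ->
  \forall h \near 0, `|g (x + h) - g x - 'd g x h| <= e * `|h|.
Proof.
move=> /diff_locally/eqaddoP/(_ e) + e0 => /(_ e0).
by apply: filterS => h; rewrite /= !fctE/= [h + x]addrC opprD addrA.
Qed.

(** The gradient of [x |-> dot l (f x)] is known only near the reference point,
    where [f] is differentiable; differentials depend on germs. *)
Lemma near_eq_diff (V W : normedModType R) (g h : V -> W) x :
  (\forall y \near x, g y = h y) -> differentiable h x ->
  differentiable g x /\ 'd g x = 'd h x :> (V -> W).
Proof.
move=> gh dh; have ghx : g x = h x by exact: nbhs_singleton gh.
have go : g \o shift x = cst (g x) + 'd h x +o_ 0 id.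
  apply/eqaddoP => e e0.
  have hP : \forall t \near 0, `|h (x + t) - h x - 'd h x t| <= e * `|t|.
    exact: diff_eps.
  have ghP : \forall t \near (0 : V), g (x + t) = h (x + t).
    by move: gh; rewrite (near_shift 0); apply: filterS => t /=; rewrite subr0 addrC.
  apply: filterS2 hP ghP => t hP gP.
  by rewrite /= !fctE/= [t + x]addrC gP ghx opprD addrA.
have dgE : 'd g x = 'd h x :> (V -> W) by apply: diff_unique => //; exact: diff_continuous.
by split=> //; apply/diff_locallyP; rewrite dgE; split=> //; exact: diff_continuous.
Qed.

Lemma cvg_diff_quotient (V W : normedModType R) (g : V -> W) x
    (T : Type) (F : set_system T) (t : T -> R) (v : T -> V) w :
  Filter F -> differentiable g x -> (forall k, 0 < t k) ->
  t @ F --> (0 : R) -> v @ F --> w ->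
  (fun k => (t k)^-1 *: (g (x + t k *: v k) - g x)) @ F --> 'd g x w.
Proof.
move=> FF dg t0 tc vc.
have dc : (fun k => 'd g x (v k)) @ F --> 'd g x w.
  by apply: cvg_comp vc _; exact: (diff_continuous dg).
apply: cvg_sub0 dc; apply/cvgr0Pnorm_le => e e0.
have M0 : 0 < `|w| + 1 by rewrite ltr_wpDl.
have tv0 : (fun k => t k *: v k) @ F --> (0 : V).
  by rewrite -(scale0r w); exact: cvgZ.
have := tv0 _ (diff_eps dg (divr_gt0 e0 M0)).
have vM : \forall k \near F, `|v k| <= `|w| + 1.
  by apply: cvgr_norm_le vc _ _; rewrite ltrDl.
apply: filterS2 vM => k vk; rewrite /= !fctE linearZ/= => gk.
rewrite -(ler_pM2l (t0 k)) -{1}(gtr0_norm (t0 k)) -normrZ scalerBr.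
rewrite scalerA divff ?gt_eqF// scale1r; apply: le_trans gk _.
rewrite normrZ gtr0_norm// mulrAC ler_pdivrMr// [t k * e]mulrC -[leRHS]mulrA.
by rewrite !ler_pM2l.
Qed.

Lemma is_derive_line (V W : normedModType R) (g : V -> W) x h (s : R) :
  differentiable g (x + s *: h) ->
  is_derive s 1 (fun r : R => g (x + r *: h)) ('d g (x + s *: h) h).
Proof.
move=> dg.
have E : (fun t : R => t^-1 *: (((fun r : R => g (x + r *: h)) \o shift s)
      (t *: (1 : R)) - g (x + s *: h))) =
    (fun t => t^-1 *: ((g \o shift (x + s *: h)) (t *: h) - g (x + s *: h))).
  apply/funext => t /=.
  by rewrite [t%:A]mulr1 scalerDl addrCA addrA [x + _]addrC -addrA.
have dd : derivable g (x + s *: h) h by exact: diff_derivable.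
apply: DeriveDef; first by rewrite /derivable E.
by rewrite /derive E -deriveE.
Qed.

End DifferenceQuotients.

Section GradientsAndTaylor.
Context {R : realType} {n m : nat}.
Implicit Types (x y h v : 'rV[R]_n).

Lemma mul_jacobian (p : nat) (g : 'rV[R]_n -> 'rV[R]_p) x v :
  v *m 'J g x = 'd g x v.
Proof. exact: mul_rV_lin1. Qed.

Lemma differentiable_dot (V : normedModType R) (l : 'rV[R]_m)
    (g : V -> 'rV[R]_m) (x : V) :
  differentiable g x ->
  differentiable (fun y : V => dot l (g y)) x /\
  forall v : V, 'D_v (fun y : V => dot l (g y)) x = dot l ('D_v g x).
Proof.
move=> dg.
have llin : linear (dot l) by move=> c u v; rewrite dotDr dotZr.
pose ldot : {linear 'rV[R]_m -> R} :=
  HB.pack (dot l) (GRing.isLinear.Build _ _ _ _ _ llin).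
have lcont : continuous ldot by exact: dot_continuous.
have dl (z : 'rV[R]_m) : differentiable ldot z by exact: linear_differentiable.
have dlg : differentiable (ldot \o g) x by exact: differentiable_comp.
split=> [//|v]; rewrite !deriveE// -[fun y : V => _]/(ldot \o g) diff_comp//=.
by have -> : 'd (dot l) (g x) = dot l :> (_ -> _) by exact: (@diff_lin _ _ _ ldot).
Qed.

Lemma differentiable_gradient (phi : 'rV[R]_n -> R) x :
  (forall v, differentiable ('D_v phi) x) -> differentiable (gradient phi) x.
Proof.
move=> dphi.
have -> : gradient phi = \sum_(i < n) (fun y =>
    'D_(delta_mx 0 i) phi y *: (delta_mx 0 i : 'rV[R]_n)).
  apply/funext => y; rewrite fct_sumE [LHS]row_sum_delta.
  by apply: eq_bigr => i _; rewrite mxE.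
by apply: differentiable_sum => i; exact: differentiableZl.
Qed.

Lemma derive_gradient (phi : 'rV[R]_n -> R) x v :
  differentiable phi x -> 'D_v phi x = dot (gradient phi x) v.
Proof.
move=> dphi; rewrite deriveE// [in LHS](row_sum_delta v) linear_sum/=.
apply: eq_bigr => i _; rewrite linearZ/= mxE deriveE//.
by rewrite mulrC.
Qed.

(** The mean value theorem applied to [s |-> L (x + s *: h)] minus its quadratic
    model, whose derivative in [s] is [o(`|h| ^+ 2)] by differentiability of the
    gradient at the single point [x]. *)
Lemma second_order_taylor (L : 'rV[R]_n -> R) (G : 'rV[R]_n -> 'rV[R]_n) x e :
  (\forall y \near x, differentiable L y /\ forall v, 'D_v L y = dot (G y) v) ->
  differentiable G x -> G x = 0 -> 0 < e ->
  \forall h \near (0 : 'rV[R]_n),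
    `|L (x + h) - L x - 2^-1 * dot ('d G x h) h| <= e * `|h| ^+ 2.
Proof.
move=> LG dG Gx e0.
pose e' := e / (n%:R + 1).
have e'0 : 0 < e' by rewrite divr_gt0// ltr_wpDl.
have [d d0 dP] : exists2 d : R, 0 < d & forall h, `|h| < d ->
    [/\ differentiable L (x + h), forall v, 'D_v L (x + h) = dot (G (x + h)) v
      & `|G (x + h) - 'd G x h| <= e' * `|h|].
  have LG0 : \forall h \near (0 : 'rV[R]_n), differentiable L (x + h) /\
      forall v, 'D_v L (x + h) = dot (G (x + h)) v.
    by move: LG; rewrite (near_shift 0); apply: filterS => t /=; rewrite subr0 addrC.
  have [d /= d0 dP] := nbhs_norm0P.1 (filterI LG0 (diff_eps dG e'0)).
  exists d => // h hd; have [[? ?]] := dP h hd.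
  by rewrite Gx subr0.
apply/nbhs_norm0P; exists d => //= h hd.
pose r s := L (x + s *: h) - s ^+ 2 * (2^-1 * dot ('d G x h) h).
pose r' s := dot (G (x + s *: h)) h - s * dot ('d G x h) h.
have sh (s : R) : 0 <= s -> s <= 1 -> `|s *: h| < d.
  move=> s0 s1; rewrite normrZ ger0_norm//; apply: le_lt_trans hd.
  by rewrite ler_piMl.
have dr (s : R) : s \in `[0, 1]%R -> is_derive s (1 : R) r (r' s).
  rewrite in_itv/= => /andP[s0 s1].
  have [dL DL _] := dP _ (sh s s0 s1).
  have /= := is_derive_line dL; rewrite -deriveE// DL => dLs.
  rewrite /r; apply: is_derive_eq.
  rewrite /r' /GRing.scale/= !mulr1 ?mul1r ?expr1.
  by field.
have rc : {within `[0, 1], continuous r}.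
  by apply: derivable_within_continuous => s /dr[].
have [c] := MVT_segment ler01 (fun s s01 => dr s (subset_itv_oo_cc s01)) rc.
rewrite in_itv/= => /andP[c0 c1].
rewrite {1 2}/r scale1r scale0r addr0 expr1n expr0n/= mul0r mul1r !subr0 mulr1.
rewrite addrAC => ->; rewrite /r'.
have [_ _ Gc] := dP _ (sh c c0 c1).
have -> : dot (G (x + c *: h)) h - c * dot ('d G x h) h =
    dot (G (x + c *: h) - 'd G x (c *: h)) h.
  have -> : 'd G x (c *: h) = c *: 'd G x h by rewrite linearZ.
  by rewrite dotBl dotZl.
apply: le_trans (dot_le_norm _ _) _.
apply: (@le_trans _ _ (n%:R * (e' * `|h| * `|h|))).
  rewrite ler_wpM2l// ler_wpM2r//; apply: le_trans Gc _.
  by rewrite ler_pM2l// normrZ ger0_norm// ler_piMl.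
have -> : n%:R * (e' * `|h| * `|h|) = n%:R * e' * `|h| ^+ 2 by ring.
rewrite ler_wpM2r ?sqr_ge0// /e' mulrA ler_pdivrMr ?ltr_wpDl//.
by rewrite mulrC ler_pM2l// lerDl.
Qed.

End GradientsAndTaylor.

(** * The Lagrangian near a stationary point *)
Section Lagrangian.
Context {R : realType} {n m : nat}.
Context (phi0 : 'rV[R]_n -> R) (f : 'rV[R]_n -> 'rV[R]_m).
Context (xbar : 'rV[R]_n) (lbar : 'rV[R]_m).
Hypothesis phi0_C2 : C2_around phi0 xbar.
Hypothesis f_C2 : C2_around f xbar.
Implicit Types (x y h v w : 'rV[R]_n) (l : 'rV[R]_m).

(** The Lagrangian up to the constant given by the conjugate function at [l]. *)
Definition smooth_lagrangian l y : R := phi0 y + dot l (f y).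

Lemma near_differentiable :
  \forall y \near xbar, differentiable phi0 y /\ differentiable f y.
Proof. by apply: filterS2 phi0_C2 f_C2 => y [? _ _] [? _ _]. Qed.

Lemma differentiable_f : differentiable f xbar.
Proof. by have [] := nbhs_singleton near_differentiable. Qed.

Lemma dot_adjoint l v y : dot (l *m ('J f y)^T) v = dot l (v *m 'J f y).
Proof. by rewrite dot_mulmx trmxK. Qed.

Lemma gradient_dot l y : differentiable f y ->
  gradient (fun y => dot l (f y)) y = l *m ('J f y)^T.
Proof.
move=> df; have [dlf DE] := differentiable_dot l df.
apply/eqP; rewrite -subr_eq0 -dot_eq0; set d := _ - _.
by rewrite {1}/d dotBl dot_adjoint -derive_gradient// DE deriveEjacobian// subrr.
Qed.

Lemma derive_smooth_lagrangian l y :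
  differentiable phi0 y -> differentiable f y ->
  differentiable (smooth_lagrangian l) y /\
  forall v, 'D_v (smooth_lagrangian l) y = dot (grad_lagrangian phi0 f y l) v.
Proof.
move=> dphi df; have [dlf DE] := differentiable_dot l df.
split=> [|v]; first exact: differentiableD.
rewrite /smooth_lagrangian deriveD; [|exact: diff_derivable..].
rewrite /grad_lagrangian dotDl dot_adjoint DE deriveEjacobian//.
by rewrite derive_gradient.
Qed.

Lemma diff_grad_lagrangian l :
  differentiable (fun y => grad_lagrangian phi0 f y l) xbar /\
  forall w, 'd (fun y => grad_lagrangian phi0 f y l) xbar w =
    w *m hess_lagrangian phi0 f xbar l.
Proof.
have [_ dphi _] := nbhs_singleton phi0_C2.
have [_ df _] := nbhs_singleton f_C2.
have dg : differentiable (gradient phi0) xbar by exact: differentiable_gradient.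
have dgf : differentiable (gradient (fun y => dot l (f y))) xbar.
  apply: differentiable_gradient => v.
  have DE : \forall y \near xbar, 'D_v (fun y => dot l (f y)) y = dot l ('D_v f y).
    by apply: filterS f_C2 => y [dfy _ _]; have [_ ->] := differentiable_dot l dfy.
  by have [dl _] := differentiable_dot l (df v); have [] := near_eq_diff DE dl.
have GE : \forall y \near xbar, grad_lagrangian phi0 f y l =
    (gradient phi0 + gradient (fun y => dot l (f y))) y.
  by apply: filterS f_C2 => y [dfy _ _]; rewrite /grad_lagrangian -gradient_dot.
have [dG dGE] := near_eq_diff GE (differentiableD dg dgf).
split=> [//|w]; rewrite (congr1 (fun g : 'rV[R]_n -> 'rV[R]_n => g w) dGE).
rewrite (congr1 (fun g : 'rV[R]_n -> 'rV[R]_n => g w) (diffD dg dgf)).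
rewrite /hess_lagrangian /hessian mulmxDr.
have E1 := mul_jacobian (gradient phi0) xbar w.
have E2 := mul_jacobian (gradient (fun y => dot l (f y))) xbar w.
by rewrite [X in _ = X + _]E1 [X in _ = _ + X]E2.
Qed.

Lemma jacobian_continuous : {for xbar, continuous (jacobian f)}.
Proof.
apply: (proj2 (@cvg_mxP R _ (nbhs xbar) _ _ _ (jacobian f) ('J f xbar))) => i j.
have [_ df _] := nbhs_singleton f_C2.
have E : \forall y \near xbar, 'D_(delta_mx 0 i) f y 0 j = 'J f y i j.
  apply: filterS f_C2 => y [dfy _ _].
  by rewrite deriveEjacobian// -rowE mxE.
have Dc : (fun y => 'D_(delta_mx 0 i) f y 0 j) @ nbhs xbar -->
    'D_(delta_mx 0 i) f xbar 0 j.
  have := differentiable_continuous (df (delta_mx 0 i)).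
  by move/(proj1 (@cvg_mxP R _ (nbhs xbar) _ _ _ ('D_(delta_mx 0 i) f) _)); exact.
have Jx : 'D_(delta_mx 0 i) f xbar 0 j = 'J f xbar i j := nbhs_singleton E.
rewrite Jx in Dc.
by apply: cvg_trans Dc; exact: near_eq_cvg.
Qed.

Lemma lagrangian_taylor e : grad_lagrangian phi0 f xbar lbar = 0 -> 0 < e ->
  \forall h \near (0 : 'rV[R]_n),
    `|smooth_lagrangian lbar (xbar + h) - smooth_lagrangian lbar xbar -
      2^-1 * dot (h *m hess_lagrangian phi0 f xbar lbar) h| <= e * `|h| ^+ 2.
Proof.
move=> G0 e0; have [dG dGE] := diff_grad_lagrangian lbar.
have LG : \forall y \near xbar, differentiable (smooth_lagrangian lbar) y /\
    forall v, 'D_v (smooth_lagrangian lbar) y = dot (grad_lagrangian phi0 f y lbar) v.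
  by apply: filterS near_differentiable => y [? ?]; exact: derive_smooth_lagrangian.
by apply: filterS (second_order_taylor LG dG G0 e0) => h; rewrite dGE.
Qed.

Section AlongSequences.
Context {T : Type} {F : set_system T} {FF : Filter F}.
Context {t : T -> R} {v : T -> 'rV[R]_n} {w : 'rV[R]_n}.
Hypothesis t_gt0 : forall k, 0 < t k.
Hypothesis t_cvg : t @ F --> (0 : R).
Hypothesis v_cvg : v @ F --> w.

Lemma cvg_quotient_f :
  (fun k => (t k)^-1 *: (f (xbar + t k *: v k) - f xbar)) @ F --> w *m 'J f xbar.
Proof.
by rewrite mul_jacobian; apply: cvg_diff_quotient => //; exact: differentiable_f.
Qed.

Lemma cvg_quotient_grad_lagrangian (mu : T -> 'rV[R]_m) (eta : 'rV[R]_m) :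
  grad_lagrangian phi0 f xbar lbar = 0 -> mu @ F --> eta ->
  (fun k => (t k)^-1 *:
     grad_lagrangian phi0 f (xbar + t k *: v k) (lbar + t k *: mu k)) @ F -->
  w *m hess_lagrangian phi0 f xbar lbar + eta *m ('J f xbar)^T.
Proof.
move=> G0 muc; have [dG dGE] := diff_grad_lagrangian lbar.
have -> : (fun k => (t k)^-1 *:
     grad_lagrangian phi0 f (xbar + t k *: v k) (lbar + t k *: mu k)) =
   (fun k => (t k)^-1 *: (grad_lagrangian phi0 f (xbar + t k *: v k) lbar -
        grad_lagrangian phi0 f xbar lbar) +
      mu k *m ('J f (xbar + t k *: v k))^T).
  apply/funext => k; rewrite G0 subr0 /grad_lagrangian mulmxDl -scalemxAl addrA.
  by rewrite [LHS]scalerDr scalerA mulVf ?gt_eqF// scale1r.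
apply: cvgD; last first.
  apply: cvg_mulmx => //; apply: cvg_trmx.
  have xc : (fun k => xbar + t k *: v k) @ F --> xbar.
    exact: cvg_add_scale t_cvg v_cvg.
  by apply: cvg_comp xc _; exact: jacobian_continuous.
by rewrite -dGE; exact: cvg_diff_quotient.
Qed.

Lemma cvg_quotient_lagrangian :
  grad_lagrangian phi0 f xbar lbar = 0 ->
  (fun k => (t k ^+ 2)^-1 * (smooth_lagrangian lbar (xbar + t k *: v k) -
     smooth_lagrangian lbar xbar)) @ F -->
  2^-1 * dot (w *m hess_lagrangian phi0 f xbar lbar) w.
Proof.
move=> G0.
have lim : (fun k => 2^-1 * dot (v k *m hess_lagrangian phi0 f xbar lbar) (v k)) @ F
    --> 2^-1 * dot (w *m hess_lagrangian phi0 f xbar lbar) w.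
  apply: cvgM; first exact: cvg_cst.
  by apply: cvg_dot => //; apply: cvg_mulmx => //; exact: cvg_cst.
apply: cvg_sub0 lim; apply/cvgr0Pnorm_le => e e0.
have M0 : 0 < (`|w| + 1) ^+ 2 by rewrite exprn_gt0// ltr_wpDl.
have tv0 : (fun k => t k *: v k) @ F --> (0 : 'rV[R]_n).
  by rewrite -(scale0r w); exact: cvgZ.
have := tv0 _ (lagrangian_taylor G0 (divr_gt0 e0 M0)).
have vM : \forall k \near F, `|v k| <= `|w| + 1.
  by apply: cvgr_norm_le v_cvg _ _; rewrite ltrDl.
apply: filterS2 vM => k vk; rewrite /= !fctE -scalemxAl dotZl dotZr => Lk.
have t20 : 0 < t k ^+ 2 by rewrite exprn_gt0.
rewrite -(ler_pM2l t20) -{1}(gtr0_norm t20) -normrM mulrBr mulrA.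
rewrite divff ?gt_eqF// mul1r.
have -> : t k ^+ 2 * (2^-1 * dot (v k *m hess_lagrangian phi0 f xbar lbar) (v k)) =
  2^-1 * (t k * (t k * dot (v k *m hess_lagrangian phi0 f xbar lbar) (v k))) by ring.
apply: le_trans Lk _.
rewrite normrZ gtr0_norm// exprMn mulrAC ler_pdivrMr// [t k ^+ 2 * e]mulrC -[leRHS]mulrA.
by rewrite !ler_pM2l// lerXn2r ?nnegrE// addr_ge0.
Qed.

End AlongSequences.

(** At a stationary point the Lagrangian can decrease at most quadratically. *)
Lemma lagrangian_lower_bound : grad_lagrangian phi0 f xbar lbar = 0 ->
  exists2 C, 0 <= C & \forall y \near xbar,
    smooth_lagrangian lbar xbar - C * dot (y - xbar) (y - xbar) <=
    smooth_lagrangian lbar y.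
Proof.
move=> G0; pose H := hess_lagrangian phi0 f xbar lbar.
have [dG dGE] := diff_grad_lagrangian lbar.
have [k k0 kP] := linear_lipschitz (diff_continuous dG).
have kn0 : 0 <= n%:R * k by rewrite mulr_ge0// ltW.
exists (n%:R * k + 1); first by rewrite addr_ge0.
rewrite (near_shift 0); apply: filterS (lagrangian_taylor G0 ltr01) => h.
rewrite /= subr0 [h + xbar]addrC [xbar + h]addrC addrK [h + xbar]addrC mul1r -/H.
have hh := norm_le_dot h.
have qP : `|dot (h *m H) h| <= n%:R * k * `|h| ^+ 2.
  apply: le_trans (dot_le_norm _ _) _.
  by rewrite expr2 -!mulrA ler_wpM2l// mulrA ler_wpM2r// -dGE.
have := ler_wpM2l kn0 hh.
move: qP; rewrite !ler_norml => /andP[q1 q2] kh /andP[l1 l2].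
have h0 : 0 <= `|h| ^+ 2 by rewrite sqr_ge0.
have nkh0 : 0 <= n%:R * k * `|h| ^+ 2 by rewrite mulr_ge0.
lra.
Qed.

End Lagrangian.

(** * Uniqueness of the multiplier, and sufficiency *)
Section StabilityOfKKT.
Context {R : realType} {n m : nat}.
Context {phi0 : 'rV[R]_n -> R} {f : 'rV[R]_n -> 'rV[R]_m}.
Context {theta : 'rV[R]_m -> \bar R}.
Context {xbar : 'rV[R]_n} {lbar : 'rV[R]_m}.
Hypothesis phi0_C2 : C2_around phi0 xbar.
Hypothesis f_C2 : C2_around f xbar.
Hypothesis theta_gtNy : forall y, (-oo < theta y)%E.
Hypothesis KKT_bar : KKT phi0 f theta xbar lbar.

Let G0 : grad_lagrangian phi0 f xbar lbar = 0 := proj1 KKT_bar.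
Let lP : subdifferential theta (f xbar) lbar := proj2 KKT_bar.

Lemma KKT_subregularP :
  strongly_metrically_subregular (@prod_enorm R n m) (@prod_enorm R n m)
    (KKT_map phi0 f theta) (xbar, lbar) (0, 0) <->
  exists2 K : R, 0 <= K & \forall z \near (xbar, lbar),
    forall y, subdifferential theta y z.2 -> sqnorm (z - (xbar, lbar)) <=
      K * sqnorm (grad_lagrangian phi0 f z.1 z.2, y - f z.1).
Proof.
split=> [/strongly_subregularP[_ [K K0 KP]]|[K K0 KP]].
  exists K => //; apply: filterS KP => z zP y yP; apply: zP.
  by exists y => //; rewrite addrC.
apply/strongly_subregularP; split.
  by exists (f xbar) => //=; rewrite G0 addNr.
by exists K => //; apply: filterS KP => z zP _ [y yP <-]; rewrite [- _ + _]addrC; exact: zP.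
Qed.

Lemma subdifferential_convex y l1 l2 s : 0 <= s -> s <= 1 ->
  subdifferential theta y l1 -> subdifferential theta y l2 ->
  subdifferential theta y (l1 + s *: (l2 - l1)).
Proof.
move=> s0 s1 /(subdifferentialP theta_gtNy)[ty l1P].
move=> /(subdifferentialP theta_gtNy)[_ l2P].
apply/(subdifferentialP theta_gtNy); split=> // z tz.
have s1' : 0 <= 1 - s by lra.
have := ler_wpM2l s0 (l2P z tz); have := ler_wpM2l s1' (l1P z tz).
by rewrite dotDl dotZl dotBl; lra.
Qed.

Lemma multipliersE l : multipliers f theta xbar (- gradient phi0 xbar) l <->
  grad_lagrangian phi0 f xbar l = 0 /\ subdifferential theta (f xbar) l.
Proof.
split=> -[l1 l2]; split=> //; last by apply/eqP; rewrite -addr_eq0 addrC; apply/eqP.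
by rewrite /grad_lagrangian l1 subrr.
Qed.

(** The multipliers form a convex set, so a second one would give solutions
    [(xbar, l)] of the KKT system with [l] arbitrarily close to [lbar]. *)
Lemma subregular_unique_multiplier :
  strongly_metrically_subregular (@prod_enorm R n m) (@prod_enorm R n m)
    (KKT_map phi0 f theta) (xbar, lbar) (0, 0) ->
  multipliers f theta xbar (- gradient phi0 xbar) = [set lbar].
Proof.
move=> /KKT_subregularP[K K0 KP]; apply/seteqP; split=> [l|_ ->]; last first.
  by apply/multipliersE.
move=> /multipliersE[Gl lsub] /=.
have lim : (fun s : R => (xbar, lbar + s *: (l - lbar))) @ 0^'+ -->
    (xbar, lbar).
  apply: cvg_pair_normed; first exact: cvg_cst.
  by apply: cvg_add_scale; [exact: cvg_within|exact: cvg_cst].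
have /filter_ex[s []] : \forall s \near (0:R)^'+, [/\ 0 < s, s < 1 &
    forall y, subdifferential theta y (lbar + s *: (l - lbar)) ->
      sqnorm ((xbar, lbar + s *: (l - lbar)) - (xbar, lbar)) <=
      K * sqnorm (grad_lagrangian phi0 f xbar (lbar + s *: (l - lbar)), y - f xbar)].
  by apply: filterS3 (nbhs_right_gt 0) (nbhs_right_lt ltr01) (lim _ KP).
move=> s0 s1 /(_ _ (subdifferential_convex (ltW s0) (ltW s1) lP lsub)).
have -> : grad_lagrangian phi0 f xbar (lbar + s *: (l - lbar)) = 0.
  have adj l' : grad_lagrangian phi0 f xbar l' = 0 ->
      l' *m ('J f xbar)^T = - gradient phi0 xbar.
    by rewrite /grad_lagrangian => /eqP; rewrite addrC addr_eq0 => /eqP.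
  rewrite /grad_lagrangian mulmxDl -scalemxAl mulmxBl !adj//.
  by rewrite subrr scaler0 addr0 subrr.
rewrite /sqnorm/= !subrr !dot0l addr0 add0r mulr0 addrC addKr dotZl dotZr mulrA.
have ss0 : 0 < s * s by rewrite mulr_gt0.
rewrite pmulr_rle0// => ll0; apply/eqP; rewrite -subr_eq0 -dot_eq0.
by rewrite eq_le ll0 dot_ge0.
Qed.

(** Points [x k] of smaller value converging to [xbar] have, after
    normalization, a limit direction [w].  Their values bound the second-order
    quotients of [theta] along [(f (x k) - f xbar) / t k], which converges to
    [w *m 'J f xbar], by minus those of the Lagrangian. *)
Lemma SOSC_local_minimizer :
  (forall w, w != 0 -> ~ low_curvature theta (f xbar) lbar (w *m 'J f xbar)
     (- dot (w *m hess_lagrangian phi0 f xbar lbar) w)) ->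
  local_minimizer (objective phi0 f theta) xbar.
Proof.
move=> soc; have [ty lsub] := (subdifferentialP theta_gtNy _ _).1 lP.
have tyE := edomE theta_gtNy ty.
split; first by rewrite /edom /objective /= tyE -EFinD ltry.
apply: contrapT => nmin.
have [x xP] := not_near_seq (fun=> nmin).
have xlt k : (objective phi0 f theta (x k) < objective phi0 f theta xbar)%E.
  by rewrite ltNge; apply/negP; have [] := xP k.
have tx k : edom theta (f (x k)).
  have := xlt k; rewrite /objective tyE -EFinD; rewrite /edom/=.
  by case: (theta (f (x k))) => [r _|//|_]; rewrite ?ltry ?ltNyy.
have {}xlt k : phi0 (x k) + fine (theta (f (x k))) < phi0 xbar + fine (theta (f xbar)).
  have := xlt k; rewrite /objective tyE (edomE theta_gtNy (tx k)).
  by rewrite -!EFinD lte_fin.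
pose t k := `|x k - xbar|; pose w k := (t k)^-1 *: (x k - xbar).
have t0 k : 0 < t k.
  rewrite normr_gt0 subr_eq0; apply/eqP => xE; have := xlt k.
  by rewrite xE ltxx.
have w1 k : `|w k| = 1.
  by rewrite normrZ gtr0_norm ?invr_gt0// mulVf// gt_eqF.
have xE k : x k = xbar + t k *: w k.
  by rewrite scalerA divff ?gt_eqF// scale1r addrC subrK.
have [U UU Uoo] := ultrafilter_oo.
have tc : t @ U --> (0 : R).
  apply: cvg_finer => //; apply: cvg_dist_harmonic => k.
  by rewrite subr0 normr_id; have [/ltW] := xP k.
have [wb wc] : exists a : 'rV[R]_n, w @ U --> a.
  by apply: (@ultra_bounded_cvg _ _ _ _ _ 1 UU); apply: nearW => k; rewrite w1.
have wb0 : wb != 0.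
  rewrite -normr_gt0; apply: lt_le_trans ltr01 _.
  by apply: (cvgr_to_ge (cvg_norm wc)); apply: nearW => k; rewrite w1.
apply: (soc wb wb0) => e e0.
have FU : Filter U by exact: _.
have vc := cvg_quotient_f (FF := FU) phi0_C2 f_C2 t0 tc wc.
have Lc := cvg_quotient_lagrangian (FF := FU) phi0_C2 f_C2 t0 tc wc G0.
have [k [tk vk Lk]] : exists k, [/\ t k < e,
    `|(t k)^-1 *: (f (xbar + t k *: w k) - f xbar) - wb *m 'J f xbar| < e &
    2^-1 * dot (wb *m hess_lagrangian phi0 f xbar lbar) wb - 2^-1 * e <=
    (t k ^+ 2)^-1 * (smooth_lagrangian phi0 f lbar (xbar + t k *: w k) -
     smooth_lagrangian phi0 f lbar xbar)].
  near U => k; exists k; split; near: k.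
  - exact: (cvgr_lt (0 : R)).
  - exact: cvgr_distC_lt.
  - by apply: cvgr_ge Lc _ _; rewrite ltrBlDr ltrDl mulr_gt0.
exists (t k), ((t k)^-1 *: (f (xbar + t k *: w k) - f xbar)); split=> //.
- by rewrite t0.
- by rewrite scalerA divff ?gt_eqF// scale1r addrC subrK -xE.
rewrite [_ *: (_ *: _)]scalerA divff ?gt_eqF// scale1r addrC subrK dotZr.
rewrite mulrA divff ?gt_eqF// mul1r.
have t20 : 0 < t k ^+ 2 by rewrite exprn_gt0.
move: Lk; rewrite ler_pdivlMl// /smooth_lagrangian -xE; have := xlt k.
by rewrite dotBr; lra.
Unshelve. all: by end_near. Qed.



End StabilityOfKKT.

Section SubregularityFromSOSC.
Context {R : realType} {n m : nat}.
Context {phi0 : 'rV[R]_n -> R} {f : 'rV[R]_n -> 'rV[R]_m}.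
Context {theta : 'rV[R]_m -> \bar R}.
Context {xbar : 'rV[R]_n} {lbar : 'rV[R]_m}.
Hypothesis phi0_C2 : C2_around phi0 xbar.
Hypothesis f_C2 : C2_around f xbar.
Hypothesis KKT_bar : KKT phi0 f theta xbar lbar.

Let G0 : grad_lagrangian phi0 f xbar lbar = 0 := proj1 KKT_bar.

Lemma sqnorm_le_norm (z : 'rV[R]_n * 'rV[R]_m) :
  sqnorm z <= (n%:R + m%:R) * `|z| ^+ 2.
Proof.
have le_norm (p : nat) (u : 'rV[R]_p) : `|u| <= `|z| -> dot u u <= p%:R * `|z| ^+ 2.
  move=> uz; apply: le_trans (le_trans (ler_norm _) (dot_le_norm _ _)) _.
  by rewrite ler_wpM2l// expr2 ler_pM.
by rewrite mulrDl lerD// le_norm// prod_normE le_max lexx ?orbT.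
Qed.

(** If subregularity fails, the normalized differences converge to a nonzero
    [(w, eta)] in the kernel of the linearized system: [eta] belongs to the
    graphical derivative of the subdifferential at [w *m 'J f xbar], and
    [w *m H + eta *m J^T = 0], with [J = 'J f xbar].  The constraint
    qualification excludes [w = 0].  For [w != 0], pairing the equation with [w]
    gives
    [dot eta (w *m J) = - dot (w *m H) w], and the left-hand side bounds the
    second subderivative, against the second-order condition. *)
Lemma SOSC_RCQ_subregular :
  (forall w, w != 0 -> ~ low_curvature theta (f xbar) lbar (w *m 'J f xbar)
     (- dot (w *m hess_lagrangian phi0 f xbar lbar) w)) ->
  (forall u eta,
     graphical_derivative (subdifferential theta) (f xbar) lbar u eta ->
     low_curvature theta (f xbar) lbar u (dot eta u)) ->
  (forall eta, graphical_derivative (subdifferential theta) (f xbar) lbar 0 eta ->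
     eta *m ('J f xbar)^T = 0 -> eta = 0) ->
  strongly_metrically_subregular (@prod_enorm R n m) (@prod_enorm R n m)
    (KKT_map phi0 f theta) (xbar, lbar) (0, 0).
Proof.
move=> soc curv rcq; apply/(KKT_subregularP KKT_bar).
apply: contrapT => nreg.
pose P k (z : 'rV[R]_n * 'rV[R]_m) := forall y, subdifferential theta y z.2 ->
  sqnorm (z - (xbar, lbar)) <=
    k.+1%:R * sqnorm (grad_lagrangian phi0 f z.1 z.2, y - f z.1).
have [z zP] : exists z, forall k, `|z k - (xbar, lbar)| < harmonic k /\ ~ P k (z k).
  by apply: not_near_seq => k Pk; apply: nreg; exists k.+1%:R.
have /choice[y yP] k : exists y, subdifferential theta y (z k).2 /\
    k.+1%:R * sqnorm (grad_lagrangian phi0 f (z k).1 (z k).2, y - f (z k).1) <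
    sqnorm (z k - (xbar, lbar)).
  have [_ /existsNP[y /not_implyP[ysub /negP]]] := zP k.
  by rewrite -ltNge => yk; exists y.
pose t k := `|z k - (xbar, lbar)|.
have t0 k : 0 < t k.
  rewrite normr_gt0; apply/eqP => zk; have [_] := yP k.
  by rewrite zk [X in _ < X]/sqnorm !dot0l addr0 ltNge mulr_ge0// sqnorm_ge0.
pose v k := (t k)^-1 *: ((z k).1 - xbar); pose mu k := (t k)^-1 *: ((z k).2 - lbar).
have vmu1 k : `|(v k, mu k)| = 1.
  have -> : (v k, mu k) = (t k)^-1 *: (z k - (xbar, lbar)) by [].
  by rewrite normrZ gtr0_norm ?invr_gt0// mulVf// gt_eqF.
have xE k : (z k).1 = xbar + t k *: v k.
  by rewrite scalerA divff ?gt_eqF// scale1r addrC subrK.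
have lE k : (z k).2 = lbar + t k *: mu k.
  by rewrite scalerA divff ?gt_eqF// scale1r addrC subrK.
have [U UU Uoo] := ultrafilter_oo.
have FU : Filter U by exact: _.
have hc : (harmonic : R^nat) @ U --> (0 : R) := cvg_finer Uoo cvg_harmonic.
have tc : t @ U --> (0 : R).
  apply: cvg_finer => //; apply: cvg_dist_harmonic => k.
  by rewrite subr0 normr_id; have [/ltW] := zP k.
have [w wc] : exists a : 'rV[R]_n, v @ U --> a.
  apply: (@ultra_bounded_cvg _ _ _ _ _ 1 UU); apply: nearW => k.
  by rewrite -(vmu1 k) prod_normE le_max lexx.
have [eta etac] : exists a : 'rV[R]_m, mu @ U --> a.
  apply: (@ultra_bounded_cvg _ _ _ _ _ 1 UU); apply: nearW => k.
  by rewrite -(vmu1 k) prod_normE le_max lexx orbT.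
have weta : 1 <= `|(w, eta)|.
  apply: (cvgr_to_ge (cvg_norm (cvg_pair_normed (FF := FU) wc etac))).
  by apply: nearW => k; rewrite vmu1.
(* The residuals of the KKT system are o(t k) *)
pose p k := (t k)^-1 *: grad_lagrangian phi0 f (z k).1 (z k).2.
pose q k := (t k)^-1 *: (y k - f (z k).1).
have pq k : dot (p k) (p k) + dot (q k) (q k) <= (n%:R + m%:R) * harmonic k.
  have [_ /ltW yk] := yP k; have := le_trans yk (sqnorm_le_norm _); rewrite -/(t k).
  rewrite -ler_pdivlMl// /sqnorm/= => /(ler_wpM2l (sqr_ge0 (t k)^-1)).
  rewrite /p /q !dotZl !dotZr /harmonic.
  have -> : (t k)^-1 ^+ 2 * (k.+1%:R^-1 * ((n%:R + m%:R) * t k ^+ 2)) =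
    ((t k)^-1 * t k) ^+ 2 * ((n%:R + m%:R) * k.+1%:R^-1) by ring.
  by rewrite mulVf ?gt_eqF// expr1n mul1r mulrDr !expr2 !mulrA.
have nmh : (fun k => (n%:R + m%:R) * harmonic k) @ U --> (0 : R).
  by rewrite -(mulr0 (n%:R + m%:R)); apply: cvgM => //; exact: cvg_cst.
have pc : p @ U --> (0 : 'rV[R]_n).
  apply: cvg_dot0; apply: squeeze_cvgr (cvg_cst 0) nmh; apply: nearW => k.
  by rewrite dot_ge0 (le_trans _ (pq k))// lerDl dot_ge0.
have qc : q @ U --> (0 : 'rV[R]_m).
  apply: cvg_dot0; apply: squeeze_cvgr (cvg_cst 0) nmh; apply: nearW => k.
  by rewrite dot_ge0 (le_trans _ (pq k))// lerDr dot_ge0.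
have stat : w *m hess_lagrangian phi0 f xbar lbar + eta *m ('J f xbar)^T = 0.
  have := cvg_quotient_grad_lagrangian (FF := FU) phi0_C2 f_C2 t0 tc wc G0 etac.
  under eq_fun do rewrite -xE -lE.
  by move=> /(cvg_unique _ pc) ->.
have uc : (fun k => (t k)^-1 *: (y k - f xbar)) @ U --> w *m 'J f xbar.
  rewrite -[X in _ --> X](addr0 (w *m _)).
  have -> : (fun k => (t k)^-1 *: (y k - f xbar)) =
      (fun k => (t k)^-1 *: (f (xbar + t k *: v k) - f xbar) + q k).
    apply/funext => k; rewrite -xE /q -scalerDr; congr (_ *: _).
    by rewrite [RHS]addrC addrA subrK.
  by apply: cvgD => //; exact: (cvg_quotient_f (FF := FU) phi0_C2 f_C2 t0 tc wc).
have tang : graphical_derivative (subdifferential theta) (f xbar) lbar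
    (w *m 'J f xbar) eta.
  apply/tangent_coneP => e e0.
  near U => k; exists (t k), ((t k)^-1 *: (y k - f xbar), mu k); split.
  - by rewrite t0/=; near: k; exact: (cvgr_lt (0 : R)).
  - near: k; apply: cvgr_distC_lt => //; exact: cvg_pair_normed.
  - rewrite /graph_of/= scalerA divff ?gt_eqF// scale1r addrC subrK -lE.
    by have [] := yP k.
have [w0|w0] := eqVneq w 0.
  have eta0 : eta = 0.
    apply: rcq; first by move: tang; rewrite w0 mul0mx.
    by move: stat; rewrite w0 mul0mx add0r.
  by move: weta; rewrite w0 eta0 prod_normE/= !normr0 maxxx ler10.
apply: (soc w w0).
have -> : - dot (w *m hess_lagrangian phi0 f xbar lbar) w = dot eta (w *m 'J f xbar).
  move/eqP: stat; rewrite addr_eq0 => /eqP ->.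
  by rewrite dotNl opprK dot_adjoint.
exact: curv.
Unshelve. all: by end_near. Qed.

End SubregularityFromSOSC.

(** * The augmented Lagrangian *)
Section AugmentedLagrangian.
Context {R : realType} {n m : nat}.
Context (phi0 : 'rV[R]_n -> R) (f : 'rV[R]_n -> 'rV[R]_m).
Context (theta : 'rV[R]_m -> \bar R).
Context (xbar : 'rV[R]_n) (lbar : 'rV[R]_m).
Hypothesis phi0_C2 : C2_around phi0 xbar.
Hypothesis f_C2 : C2_around f xbar.
Hypothesis theta_gtNy : forall y, (-oo < theta y)%E.
Hypothesis theta_convex : convex_efun theta.
Implicit Types (x z v w : 'rV[R]_n) (y l : 'rV[R]_m) (r d : R).

Local Notation lagr := (smooth_lagrangian phi0 f lbar).

(** The composite problem with [f x = y] as a constraint: its Lagrangian for the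
    multiplier [lbar], a quadratic penalty with parameter [r], and a proximal
    term that pulls [x] towards [z]. *)
Definition augmented r d z x y : R :=
  lagr x + (fine (theta y) - dot lbar y) +
  2^-1 * r * dot (f x - y) (f x - y) + 2^-1 * d * dot (x - z) (x - z).

(** The two stationarity conditions say that [(x, lbar + r *: (f x - y))] solves
    the KKT system up to the residual [- (d *: (x - z))] in the first component
    and [y - f x] in the second.  The latter is, up to sign, [r^-1] times the
    deviation of the multiplier from [lbar], so subregularity absorbs it for
    large [r]. *)
Lemma augmented_stationary_y r d z x y : edom theta y ->
  (\forall y' \near y, edom theta y' ->
     augmented r d z x y <= augmented r d z x y') ->
  subdifferential theta y (lbar + r *: (f x - y)).
Proof.
move=> ty ymin; apply/(subdifferentialP theta_gtNy); split=> // y' ty'.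
rewrite -lerBrDl.
apply: (@le_first_order _ _ _ (2^-1 * r * dot (y' - y) (y' - y))).
have lim : (fun s : R => y + s *: (y' - y)) @ 0^'+ --> y.
  by apply: cvg_add_scale; [exact: cvg_within|exact: cvg_cst].
apply: filterS3 (nbhs_right_gt 0) (nbhs_right_lt ltr01) (lim _ ymin) => s s0 s1.
have [ts cvx] := convex_fine theta_gtNy theta_convex ty ty' s0 s1.
move=> /(_ ts); rewrite /augmented -(ler_pM2l s0 (dot _ _)).
have -> : f x - (y + s *: (y' - y)) = (f x - y) - s *: (y' - y).
  by rewrite opprD addrA.
rewrite !dotE (dotC y (f x)) (dotC y' (f x)) (dotC y' y); lra.
Qed.

Lemma augmented_stationary_x r d z x y :
  differentiable phi0 x -> differentiable f x ->
  (\forall x' \near x, augmented r d z x y <= augmented r d z x' y) ->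
  grad_lagrangian phi0 f x (lbar + r *: (f x - y)) = - (d *: (x - z)).
Proof.
move=> dphi df xmin; have [dL DL] := derive_smooth_lagrangian lbar dphi df.
set l := lbar + _.
suff G0 v : 0 <= dot (grad_lagrangian phi0 f x l + d *: (x - z)) v.
  apply/eqP; rewrite -addr_eq0 -dot_eq0 eq_le dot_ge0 andbT -oppr_ge0 -dotNr.
  exact: G0.
pose t : R^nat := harmonic.
have t0 k : 0 < t k := harmonic_gt0 k.
have tc : t @ \oo --> (0 : R) := cvg_harmonic.
have vc : (fun=> v) @ \oo --> v by exact: cvg_cst.
pose q k := (t k)^-1 *: (lagr (x + t k *: v) - lagr x).
pose F k := (t k)^-1 *: (f (x + t k *: v) - f x).
have qc : q @ \oo --> 'd lagr x v by exact: cvg_diff_quotient.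
have Fc : F @ \oo --> 'd f x v by exact: cvg_diff_quotient.
have xc : (fun k => x + t k *: v) @ \oo --> x by exact: cvg_add_scale tc vc.
pose Q k := q k + (r * dot (f x - y) (F k) + t k * (2^-1 * r * dot (F k) (F k))) +
  (d * dot (x - z) v + t k * (2^-1 * d * dot v v)).
have Qc : Q @ \oo --> 'd lagr x v +
    (r * dot (f x - y) ('d f x v) + 0 * (2^-1 * r * dot ('d f x v) ('d f x v))) +
    (d * dot (x - z) v + 0 * (2^-1 * d * dot v v)).
  apply: cvgD; first apply: cvgD => //; first apply: cvgD.
  - apply: cvgM; first exact: cvg_cst.
    by apply: cvg_dot => //; exact: cvg_cst.
  - apply: cvgM => //; apply: cvgM; first exact: cvg_cst.
    exact: cvg_dot.
  - by apply: cvgD; [exact: cvg_cst|exact: cvgMr_tmp].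
rewrite !mul0r !addr0 in Qc.
have -> : dot (grad_lagrangian phi0 f x l + d *: (x - z)) v =
    'd lagr x v + r * dot (f x - y) ('d f x v) + d * dot (x - z) v.
  rewrite -deriveE// DL -mul_jacobian -dot_adjoint -dotZl -!dotDl -dotZl -dotDl.
  by congr (dot (_ + _) _); rewrite /grad_lagrangian /l mulmxDl -scalemxAl addrA.
have xm : \forall k \near \oo,
    augmented r d z x y <= augmented r d z (x + t k *: v) y by exact: (xc _ xmin).
apply: (cvgr_to_ge Qc); apply: filterS xm => k xk.
rewrite -(pmulr_rge0 _ (t0 k)).
have lE : lagr (x + t k *: v) = lagr x + t k * q k.
  by rewrite /q /GRing.scale/= mulrA divff ?gt_eqF// mul1r [RHS]addrC subrK.
have fE : f (x + t k *: v) - y = (f x - y) + t k *: F k.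
  by rewrite /F scalerA divff ?gt_eqF// scale1r [RHS]addrC addrA subrK.
have zE : x + t k *: v - z = (x - z) + t k *: v by rewrite addrAC.
move: xk; rewrite /augmented lE fE zE /Q.
move: (f x - y) (F k) (x - z) => E Fk D.
by rewrite !dotE (dotC Fk E) (dotC v D); lra.
Qed.


(** Uniqueness of the multiplier acts as a constraint qualification.  The
    multipliers are not known to be bounded, so the limit is taken of
    [tau *: l] and [tau] with [tau = (1 + `|l|)^-1], giving [a] and [t].  These
    satisfy a homogenized KKT system, which makes [(1 - t) *: lbar + a] a
    multiplier.  Hence [a = t *: lbar]; since [`|a| = 1 - t], the case [t = 0]
    of unbounded multipliers is impossible. *)
Lemma multiplier_cvg (U : set_system nat) (x : nat -> 'rV[R]_n)
    (y l : nat -> 'rV[R]_m) :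
  UltraFilter U ->
  multipliers f theta xbar (- gradient phi0 xbar) = [set lbar] ->
  x @ U --> xbar -> y @ U --> f xbar ->
  (fun k => fine (theta (y k))) @ U --> fine (theta (f xbar)) ->
  (fun k => grad_lagrangian phi0 f (x k) (l k)) @ U --> (0 : 'rV[R]_n) ->
  (\forall k \near U, subdifferential theta (y k) (l k)) ->
  l @ U --> lbar.
Proof.
move=> UU uniq xc yc thc gc lsub.
have FU : Filter U by exact: _.
have : multipliers f theta xbar (- gradient phi0 xbar) lbar by rewrite uniq.
move=> /multipliersE[G0 /(subdifferentialP theta_gtNy)[ty lbarP]].
pose tau k := (1 + `|l k|)^-1; pose mu k := tau k *: l k.
have den0 k : 0 < 1 + `|l k| by rewrite ltr_wpDr.
have tau0 k : 0 < tau k by rewrite invr_gt0.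
have mu_norm k : `|mu k| = 1 - tau k.
  rewrite normrZ gtr0_norm// /tau; apply: (mulfI (lt0r_neq0 (den0 k))).
  by rewrite mulrA mulrBr divff ?gt_eqF// mul1r mulr1; ring.
have tau1 k : tau k <= 1 by rewrite -subr_ge0 -mu_norm.
have [t tc] : exists t : R, tau @ U --> t.
  by apply: (ultra_bounded_cvg_real UU) => k; rewrite ger0_norm// ltW.
have [a ac] : exists a : 'rV[R]_m, mu @ U --> a.
  apply: (@ultra_bounded_cvg _ _ _ _ _ 1 UU); apply: nearW => k.
  by rewrite mu_norm gerBl ltW.
have t_ge0 : 0 <= t by apply: (cvgr_to_ge tc); apply: nearW => k; exact: ltW.
have t_le1 : t <= 1 by apply: (cvgr_to_le tc); apply: nearW.
have a_norm : `|a| = 1 - t.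
  have c1 : (fun k => `|mu k|) @ U --> `|a| by exact: cvg_norm.
  have c2 : (fun k => 1 - tau k) @ U --> 1 - t.
    by apply: cvgB => //; exact: cvg_cst.
  have E : (fun k => `|mu k|) = (fun k => 1 - tau k) by apply/funext.
  rewrite E in c1.
  exact: (limit_unique _ c1 c2).
have stat : t *: gradient phi0 xbar + a *m ('J f xbar)^T = 0.
  have dphi : gradient phi0 @ xbar --> gradient phi0 xbar.
    apply: differentiable_continuous; apply: differentiable_gradient.
    by have [] := nbhs_singleton phi0_C2.
  have c1 : (fun k => tau k *: grad_lagrangian phi0 f (x k) (l k)) @ U -->
      t *: (0 : 'rV[R]_n) by exact: cvgZ.
  have c2 : (fun k => tau k *: gradient phi0 (x k) + mu k *m ('J f (x k))^T) @ U -->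
      t *: gradient phi0 xbar + a *m ('J f xbar)^T.
    apply: cvgD; first by apply: cvgZ => //; exact: cvg_comp xc dphi.
    apply: cvg_mulmx => //; apply: cvg_trmx.
    by apply: cvg_comp xc _; exact: (jacobian_continuous f_C2).
  rewrite scaler0 in c1.
  rewrite (_ : (fun k => tau k *: grad_lagrangian phi0 f (x k) (l k)) =
    (fun k => tau k *: gradient phi0 (x k) + mu k *m ('J f (x k))^T)) in c1.
    exact: (limit_unique _ c2 c1).
  by apply/funext => k; rewrite /grad_lagrangian scalerDr -scalemxAl.
have asub (z : 'rV[R]_m) : edom theta z ->
    t * fine (theta (f xbar)) + dot a (z - f xbar) <= t * fine (theta z).
  move=> tz; apply: (@ler_cvg_to _ U _ _
    (fun k => tau k * fine (theta (y k)) + dot (mu k) (z - y k))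
    (fun k => tau k * fine (theta z))).
  - apply: cvgD; first exact: cvgM.
    by apply: cvg_dot => //; apply: cvgB => //; exact: cvg_cst.
  - by apply: cvgM => //; exact: cvg_cst.
  - apply: filterS lsub => k /(subdifferentialP theta_gtNy)[_ /(_ z tz) lk].
    by rewrite dotZl -mulrDr ler_pM2l.
have : multipliers f theta xbar (- gradient phi0 xbar) ((1 - t) *: lbar + a).
  apply/multipliersE; split.
    rewrite /grad_lagrangian mulmxDl -scalemxAl.
    have -> : lbar *m ('J f xbar)^T = - gradient phi0 xbar.
      by apply/eqP; rewrite -addr_eq0 addrC; apply/eqP.
    rewrite scalerN scalerBl scale1r opprB addrA addrCA subrr addr0.
    exact: stat.
  apply/(subdifferentialP theta_gtNy); split=> // z tz.
  have t1' : 0 <= 1 - t by rewrite subr_ge0.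
  have := asub z tz; have := ler_wpM2l t1' (lbarP z tz).
  by rewrite dotDl dotZl; lra.
rewrite uniq /= scalerBl scale1r => /eqP.
rewrite -subr_eq0 addrAC [lbar - _]addrC addrK addrC subr_eq0 => /eqP aE.
have t_neq0 : t != 0.
  apply/eqP => t0; move: a_norm; rewrite aE t0 scale0r normr0 subr0 => /eqP.
  by rewrite eq_sym oner_eq0.
have -> : l = (fun k => (tau k)^-1 *: mu k).
  by apply/funext => k; rewrite /mu scalerA mulVf ?gt_eqF// scale1r.
have -> : lbar = t^-1 *: a by rewrite aE scalerA mulVf// scale1r.
by apply: cvgZ => //; exact: cvgV.
Qed.

(** Closedness of the domain and continuity along sequences in it: minimizing
    sequences of the augmented Lagrangian then have minimizers as limits. *)
Hypothesis theta_lim : forall (U : set_system nat) (y : nat -> 'rV[R]_m) a,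
  UltraFilter U -> (forall k, edom theta (y k)) -> y @ U --> a ->
  edom theta a /\ (fun k => fine (theta (y k))) @ U --> fine (theta a).

Lemma augmented_minimizer (rho r d C : R) z :
  KKT phi0 f theta xbar lbar -> 0 < rho -> 0 <= r -> 0 <= d -> 0 <= C ->
  (forall x, `|x - xbar| <= rho ->
    [/\ differentiable phi0 x, differentiable f x &
      lagr xbar - C * dot (x - xbar) (x - xbar) <= lagr x]) ->
  exists x y, [/\ `|x - xbar| <= rho, `|y - f xbar| <= rho, edom theta y &
    forall x' y', `|x' - xbar| <= rho -> `|y' - f xbar| <= rho ->
      edom theta y' -> augmented r d z x y <= augmented r d z x' y'].
Proof.
move=> [_ lP] rho0 r0 d0 C0 xP.
have [ty lsub] := (subdifferentialP theta_gtNy _ _).1 lP.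
pose D := [set p : 'rV[R]_n * 'rV[R]_m |
  [/\ `|p.1 - xbar| <= rho, `|p.2 - f xbar| <= rho & edom theta p.2]].
pose V := [set augmented r d z p.1 p.2 | p in D].
have Vinf : has_inf V.
  split.
    exists (augmented r d z xbar (f xbar)), (xbar, f xbar) => //.
    by rewrite /D/= !subrr !normr0 (ltW rho0).
  exists (lagr xbar - C * (n%:R * rho ^+ 2) + (fine (theta (f xbar)) - dot lbar (f xbar))).
  move=> _ [[x y] /= [xr yr tdy] <-]; rewrite /augmented.
  have [_ _ Lx] := xP x xr; have := lsub y tdy; rewrite dotBr => My.
  have xx : dot (x - xbar) (x - xbar) <= n%:R * rho ^+ 2.
    apply: le_trans (le_trans (ler_norm _) (dot_le_norm _ _)) _.
    by rewrite ler_wpM2l// expr2 ler_pM.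
  have := ler_wpM2l C0 xx.
  have q1 : 0 <= 2^-1 * r * dot (f x - y) (f x - y).
    by rewrite !mulr_ge0 ?invr_ge0 ?dot_ge0.
  have q2 : 0 <= 2^-1 * d * dot (x - z) (x - z).
    by rewrite !mulr_ge0 ?invr_ge0 ?dot_ge0.
  lra.
have /choice[p pP] k : exists p, D p /\ augmented r d z p.1 p.2 < inf V + harmonic k.
  have [_ [p Dp <-] pk] := inf_adherent (harmonic_gt0 k) Vinf.
  by exists p.
have [U UU Uoo] := ultrafilter_oo.
have FU : Filter U by exact: _.
have hc : (harmonic : R^nat) @ U --> (0 : R) := cvg_finer Uoo cvg_harmonic.
have p1r k : `|(p k).1 - xbar| <= rho by have [[]] := pP k.
have p2r k : `|(p k).2 - f xbar| <= rho by have [[]] := pP k.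
have [x xc xr] := ultra_ball_cvg UU p1r.
have [y yc yr] := ultra_ball_cvg UU p2r.
have pD k : edom theta (p k).2 by have [[]] := pP k.
have [tdy thc] := theta_lim UU pD yc.
have [dphi df _] := xP x xr.
have fc : (fun k => f (p k).1) @ U --> f x.
  by apply: cvg_comp xc _; exact: (differentiable_continuous df).
have Lc : (fun k => lagr (p k).1) @ U --> lagr x.
  have [dL _] := derive_smooth_lagrangian lbar dphi df.
  by apply: cvg_comp xc _; exact: (differentiable_continuous dL).
have Ac : (fun k => augmented r d z (p k).1 (p k).2) @ U --> augmented r d z x y.
  apply: cvgD; [apply: cvgD; [apply: cvgD => //; apply: cvgB => //|]|].
  - by apply: cvg_dot => //; exact: cvg_cst.
  - apply: cvgM; first exact: cvg_cst.
    by apply: cvg_dot; exact: cvgB.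
  - apply: cvgM; first exact: cvg_cst.
    by apply: cvg_dot; apply: cvgB => //; exact: cvg_cst.
have Ax : augmented r d z x y <= inf V.
  rewrite -[leRHS]addr0; apply: (@ler_cvg_to _ U _ _ _ _ _ _ Ac).
    by apply: cvgD hc; exact: cvg_cst.
  by apply: nearW => k; have [_ /ltW] := pP k.
exists x, y; split=> // x' y' x'r y'r ty'; apply: le_trans Ax _.
by apply: ge_inf; [case: Vinf|exists (x', y')].
Qed.


End AugmentedLagrangian.

(** * Necessity of the second-order condition *)
Section SOSCFromSubregularity.
Context {R : realType} {n m : nat}.
Context {phi0 : 'rV[R]_n -> R} {f : 'rV[R]_n -> 'rV[R]_m}.
Context {theta : 'rV[R]_m -> \bar R}.
Context {xbar : 'rV[R]_n} {lbar : 'rV[R]_m}.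
Hypothesis phi0_C2 : C2_around phi0 xbar.
Hypothesis f_C2 : C2_around f xbar.
Hypothesis theta_gtNy : forall y, (-oo < theta y)%E.
Hypothesis theta_convex : convex_efun theta.
Hypothesis theta_lim : forall (U : set_system nat) (y : nat -> 'rV[R]_m) a,
  UltraFilter U -> (forall k, edom theta (y k)) -> y @ U --> a ->
  edom theta a /\ (fun k => fine (theta (y k))) @ U --> fine (theta a).
Hypothesis KKT_bar : KKT phi0 f theta xbar lbar.

Local Notation lagr := (smooth_lagrangian phi0 f lbar).
Local Notation aug := (augmented phi0 f theta lbar).
Local Notation H := (hess_lagrangian phi0 f xbar lbar).

Let G0 : grad_lagrangian phi0 f xbar lbar = 0 := proj1 KKT_bar.

Let base : R := lagr xbar + (fine (theta (f xbar)) - dot lbar (f xbar)).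

(** If the second-order condition fails at [w], there are points near
    [(xbar + t *: w, f xbar + t *: (w *m 'J f xbar))] whose augmented value
    exceeds the one at [(xbar, f xbar)] by an arbitrarily small multiple of
    [t ^+ 2].  The penalty parameter [e^-1] is harmless as the feasibility gap
    is at most [2 * e * t]. *)
Lemma low_curvature_competitor w rho e d :
  low_curvature theta (f xbar) lbar (w *m 'J f xbar) (- dot (w *m H) w) ->
  0 < rho -> 0 < e ->
  exists t y, [/\ 0 < t < e, `|t *: w| <= rho, `|y - f xbar| <= rho,
    edom theta y &
    aug e^-1 d (xbar + t *: w) (xbar + t *: w) y <=
      base + (2 * m%:R + 2) * t ^+ 2 * e].
Proof.
move=> d2 rho0 e0; set u := w *m 'J f xbar in d2.
have [dphi df] := nbhs_singleton (near_differentiable phi0_C2 f_C2).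
have w10 : 0 < `|w| + 1 by rewrite ltr_wpDl.
have u0 : 0 < `|u| + e by rewrite ltr_wpDl.
have tw : (fun t : R => t *: w) @ 0^'+ --> (0 : 'rV[R]_n).
  by rewrite -(scale0r w); apply: cvgZr_tmp; exact: cvg_within.
have N3 : \forall t \near (0 : R)^'+,
    `|f (xbar + t *: w) - f xbar - t *: u| <= e * t.
  have := tw _ (diff_eps df (divr_gt0 e0 w10)).
  apply: filterS2 (nbhs_right_gt 0) => t t0 /=.
  rewrite -mul_jacobian -scalemxAl -/u => /le_trans; apply.
  rewrite normrZ gtr0_norm// mulrAC ler_pdivrMr// -mulrA ler_pM2l// ler_pM2l//.
  by rewrite lerDl.
have N4 : \forall t \near (0 : R)^'+,
    lagr (xbar + t *: w) <= lagr xbar + 2^-1 * t ^+ 2 * dot (w *m H) w + e * t ^+ 2.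
  have w120 : 0 < (`|w| + 1) ^+ 2 by rewrite exprn_gt0.
  have := tw _ (lagrangian_taylor phi0_C2 f_C2 G0 (divr_gt0 e0 w120)).
  apply: filterS2 (nbhs_right_gt 0) => t t0 /=.
  rewrite -scalemxAl dotZl dotZr ler_norml => /andP[_] Lt.
  have : e / (`|w| + 1) ^+ 2 * `|t *: w| ^+ 2 <= e * t ^+ 2.
    rewrite normrZ gtr0_norm// mulrAC ler_pdivrMr// -mulrA ler_pM2l// exprMn.
    by rewrite ler_pM2l ?exprn_gt0// lerXn2r ?nnegrE ?addr_ge0// lerDl.
  move: Lt; rewrite expr2; lra.
have N12 : \forall t \near (0 : R)^'+, t <= rho / (`|w| + 1) /\ t <= rho / (`|u| + e).
  by apply: filterS2 (nbhs_right_le (divr_gt0 rho0 w10))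
    (nbhs_right_le (divr_gt0 rho0 u0)) => t.
have [t0 /= t00 tP] := filterI N12 (filterI N3 N4).
have e't0 : 0 < Num.min e t0 by rewrite lt_min e0.
have [t [v [/andP[tgt0]]]] := d2 _ e't0.
rewrite !lt_min => /andP[te tt0] /andP[ve _] tv tvP.
have [] := tP t; rewrite /ball_/= ?sub0r ?normrN ?gtr0_norm//.
rewrite !ler_pdivlMr// => -[tw1 tu1] [fe Le].
exists t, (f xbar + t *: v); split=> //.
- by rewrite tgt0.
- rewrite normrZ gtr0_norm//; apply: le_trans tw1.
  by rewrite ler_pM2l// lerDl.
- rewrite addrC addKr normrZ gtr0_norm//; apply: le_trans tu1.
  rewrite ler_pM2l// -[v](subrK u) addrC (le_trans (ler_normD _ _))//.
  by rewrite lerD2l ltW.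
have vu : `|f (xbar + t *: w) - (f xbar + t *: v)| <= 2 * (e * t).
  have -> : f (xbar + t *: w) - (f xbar + t *: v) =
      (f (xbar + t *: w) - f xbar - t *: u) - t *: (v - u).
    by rewrite scalerBr opprB addrA subrK opprD addrA.
  rewrite (le_trans (ler_normB _ _))// mulr2n mulrDl mul1r lerD//.
  by rewrite normrZ gtr0_norm// mulrC ler_pM2r// ltW.
have pen : 2^-1 * e^-1 * dot (f (xbar + t *: w) - (f xbar + t *: v))
    (f (xbar + t *: w) - (f xbar + t *: v)) <= 2 * m%:R * t ^+ 2 * e.
  apply: (@le_trans _ _ (2^-1 * e^-1 * (m%:R * (2 * (e * t) * (2 * (e * t)))))).
    rewrite ler_wpM2l ?mulr_ge0 ?invr_ge0 ?(ltW e0)//.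
    apply: le_trans (le_trans (ler_norm _) (dot_le_norm _ _)) _.
    by rewrite ler_wpM2l// ler_pM.
  have -> : 2^-1 * e^-1 * (m%:R * (2 * (e * t) * (2 * (e * t)))) =
      2 * m%:R * t ^+ 2 * e by field; rewrite gt_eqF.
  by [].
rewrite /augmented subrr dot0l mulr0 addr0 /base.
have me : 2^-1 * t ^+ 2 * Num.min e t0 <= 2^-1 * t ^+ 2 * e.
  apply: ler_wpM2l; first by rewrite mulr_ge0 ?invr_ge0 ?sqr_ge0.
  by rewrite ge_min lexx.
have e1 : 0 <= t ^+ 2 * e by rewrite mulr_ge0 ?sqr_ge0// ltW.
have -> : dot lbar (f xbar + t *: v) = dot lbar (f xbar) + t * dot lbar v.
  by rewrite dotDr dotZr.
move: pen me e1 Le tvP.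
set a1 := dot (w *m H) w; set b1 := dot (_ - _) _; set mn := Num.min e t0; lra.
Qed.

(** Suppose that the second-order condition fails at [w].  Let [(x k, y k)]
    minimize the augmented Lagrangian, with penalty parameter [(e k)^-1] and
    proximal centre [z k = xbar + t k *: w], over a fixed ball.
    As [xbar] is a local minimizer, [x k] tends to [xbar], and the induced
    multipliers tend to [lbar].  Subregularity then yields
    [`|x k - xbar| = O(d * t k)]: for small [d] the minimizer stays near [xbar],
    and the proximal term costs of the order of [d * t k ^+ 2], whereas the
    Lagrangian can gain only [O(d ^+ 2 * t k ^+ 2)].  The competitor near [z k]
    does better. *)
Lemma subregular_SOSC :
  strongly_metrically_subregular (@prod_enorm R n m) (@prod_enorm R n m)
    (KKT_map phi0 f theta) (xbar, lbar) (0, 0) ->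
  local_minimizer (objective phi0 f theta) xbar ->
  forall w, w != 0 -> ~ low_curvature theta (f xbar) lbar (w *m 'J f xbar)
     (- dot (w *m H) w).
Proof.
move=> reg [_ locmin] w w0 d2.
have uniq := subregular_unique_multiplier theta_gtNy KKT_bar reg.
have [K K0 KP] := (KKT_subregularP KKT_bar).1 reg.
have [C C0 CP] := lagrangian_lower_bound phi0_C2 f_C2 G0.
have [ty lsub] := (subdifferentialP theta_gtNy _ _).1 (proj2 KKT_bar).
have [rho rho0 rP] : exists2 rho : R, 0 < rho & forall x, `|x - xbar| <= rho ->
    [/\ differentiable phi0 x, differentiable f x,
      lagr xbar - C * dot (x - xbar) (x - xbar) <= lagr x &
      (objective phi0 f theta xbar <= objective phi0 f theta x)%E].
  have [r /= r0 rP] := (nbhs_ballP _ _).1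
    (filterI (near_differentiable phi0_C2 f_C2) (filterI CP locmin)).
  exists (r / 2); first by rewrite divr_gt0.
  move=> x xr.
  have xball : ball xbar r x.
    rewrite -ball_normE /ball_/= distrC (le_lt_trans xr)//.
    by rewrite ltr_pdivrMr// ltr_pMr// ltr1n.
  by have [[? ?] [? ?]] := rP x xball.
have rP3 x : `|x - xbar| <= rho -> [/\ differentiable phi0 x, differentiable f x &
    lagr xbar - C * dot (x - xbar) (x - xbar) <= lagr x].
  by move=> /rP[].
pose W := dot w w; have W0 : 0 < W by exact: dot_gt0.
(* d is small enough for (C + 1) * K * d <= 1/32 and d <= 1/32, so that the
   final comparison of coefficients of t ^+ 2 has a definite sign *)
have CK0 : 0 < 32 * ((C + 1) * (K + 1)).
  by rewrite !mulr_gt0// ltr_wpDl.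
pose d := (32 * ((C + 1) * (K + 1)))^-1; have d0 : 0 < d by rewrite invr_gt0.
pose B : R := 2 * m%:R + 2; have B0 : 0 < B by rewrite ltr_wpDl ?mulr_ge0.
pose e : R^nat := harmonic; have e0 k : 0 < e k := harmonic_gt0 k.
have e1 k : e k <= 1 by rewrite invf_le1// ler1n.
have /choice[cp cpP] k : exists p : R * 'rV[R]_m, [/\ 0 < p.1 < e k,
    `|p.1 *: w| <= rho, `|p.2 - f xbar| <= rho, edom theta p.2 &
    aug (e k)^-1 d (xbar + p.1 *: w) (xbar + p.1 *: w) p.2 <=
      base + B * p.1 ^+ 2 * e k].
  have [t [y cpP]] := low_curvature_competitor d d2 rho0 (e0 k).
  by exists (t, y).
pose t k := (cp k).1.
have t0 k : 0 < t k by have [/andP[]] := cpP k.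
have te k : t k < e k by have [/andP[]] := cpP k.
pose z k := xbar + t k *: w.
have /choice[xy xyP] k : exists p : 'rV[R]_n * 'rV[R]_m, [/\ `|p.1 - xbar| <= rho,
    `|p.2 - f xbar| <= rho, edom theta p.2 &
    forall x' y', `|x' - xbar| <= rho -> `|y' - f xbar| <= rho ->
      edom theta y' -> aug (e k)^-1 d (z k) p.1 p.2 <= aug (e k)^-1 d (z k) x' y'].
  have ei0 : 0 <= (e k)^-1 by rewrite invr_ge0 ltW.
  have [x [y xyP]] := augmented_minimizer theta_gtNy theta_lim (z k)
    KKT_bar rho0 ei0 (ltW d0) C0 rP3.
  by exists (x, y).
pose x k := (xy k).1; pose y k := (xy k).2.
have xr k : `|x k - xbar| <= rho by have [] := xyP k.
have yr k : `|y k - f xbar| <= rho by have [] := xyP k.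
have tdy k : edom theta (y k) by have [] := xyP k.
have xymin k x' y' : `|x' - xbar| <= rho -> `|y' - f xbar| <= rho ->
    edom theta y' -> aug (e k)^-1 d (z k) (x k) (y k) <= aug (e k)^-1 d (z k) x' y'.
  by have [_ _ _] := xyP k; exact.
have upper k : aug (e k)^-1 d (z k) (x k) (y k) <= base + B * t k ^+ 2 * e k.
  have [_ tw yk tdyk le] := cpP k; apply: le_trans le; apply: xymin => //.
  by rewrite /z addrC addKr.
pose dx k := dot (x k - xbar) (x k - xbar).
pose dz k := dot (x k - z k) (x k - z k).
pose df k := dot (f (x k) - y k) (f (x k) - y k).
have lowM k : fine (theta (f xbar)) - dot lbar (f xbar) <=
    fine (theta (y k)) - dot lbar (y k).
  by have := lsub _ (tdy k); rewrite dotBr; lra.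
have lowL k : lagr xbar - C * dx k <= lagr (x k) by have [_ _] := rP3 _ (xr k).
have dx0 k : 0 <= dx k by exact: dot_ge0.
have dz0 k : 0 <= dz k by exact: dot_ge0.
have df0 k : 0 <= df k by exact: dot_ge0.
have ddz0 k : 0 <= 2^-1 * d * dz k.
  by apply: mulr_ge0 (dz0 k); apply: mulr_ge0 (ltW d0); rewrite invr_ge0.
have edf0 k : 0 <= 2^-1 * (e k)^-1 * df k.
  by apply: mulr_ge0 (df0 k); rewrite mulr_ge0// invr_ge0// ltW.
have t2e k : t k ^+ 2 * e k <= e k.
  rewrite ler_piMl ?(ltW (e0 k))// -[leRHS](expr1n _ 2).
  by rewrite lerXn2r ?nnegrE ?(ltW (t0 k))// (le_trans (ltW (te k))).
have [U UU Uoo] := ultrafilter_oo.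
have FU : Filter U by exact: _.
have ec : e @ U --> (0 : R) := cvg_finer Uoo cvg_harmonic.
have tc : t @ U --> (0 : R).
  apply: squeeze_cvgr (cvg_cst 0) ec; apply: nearW => k.
  by rewrite (ltW (t0 k)) (ltW (te k)).
have [a ac ar] := ultra_ball_cvg UU xr.
have [b bc _] := ultra_ball_cvg UU yr.
have [tdb thc] := theta_lim UU tdy bc.
have [dphia dfa _ amin] := rP a ar.
have fac : (fun k => f (x k)) @ U --> f a.
  by apply: cvg_comp ac _; exact: (differentiable_continuous dfa).
have Lac : (fun k => lagr (x k)) @ U --> lagr a.
  have [dL _] := derive_smooth_lagrangian lbar dphia dfa.
  by apply: cvg_comp ac _; exact: (differentiable_continuous dL).
(* The penalty makes the limit point (a, b) feasible *)
have fab : f a = b.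
  pose Q := 2 * (B + C * (n%:R * rho ^+ 2)).
  have dfQ k : df k <= Q * e k.
    have dxr : dx k <= n%:R * rho ^+ 2.
      apply: le_trans (le_trans (ler_norm _) (dot_le_norm _ _)) _.
      by rewrite ler_wpM2l// expr2 ler_pM.
    have h1 := ler_wpM2l C0 dxr; have h2 := ler_wpM2l (ltW B0) (t2e k).
    have h3 := ler_wpM2l (ltW B0) (e1 k).
    have h4 : 2^-1 * (e k)^-1 * df k <= B + C * (n%:R * rho ^+ 2).
      have := upper k; have := lowM k; have := lowL k; have := ddz0 k.
      by rewrite /augmented -/(df k) -/(dz k) /base; lra.
    rewrite -[leLHS]mul1r -(divff (lt0r_neq0 (e0 k))) /Q.
    have := ler_wpM2r (ltW (e0 k)) h4; lra.
  have dfc : df @ U --> (0 : R).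
    have Qc : (fun k => Q * e k) @ U --> (0 : R).
      by rewrite -(mulr0 Q); apply: cvgM => //; exact: cvg_cst.
    by apply: squeeze_cvgr (cvg_cst 0) Qc; apply: nearW => k; rewrite df0 dfQ.
  apply/eqP; rewrite -subr_eq0; apply/eqP.
  have c1 : (fun k => f (x k) - y k) @ U --> f a - b by exact: cvgB.
  exact: (limit_unique _ c1 (cvg_dot0 dfc)).
have zc : z @ U --> xbar by exact: cvg_add_scale tc (cvg_cst w).
(* The proximal term makes xbar the only minimizer of the limit problem *)
have axbar : a = xbar.
  have dzc : dz @ U --> dot (a - xbar) (a - xbar).
    by apply: cvg_dot; exact: cvgB.
  have : lagr a + (fine (theta b) - dot lbar b) + 2^-1 * d * dot (a - xbar) (a - xbar)
      <= base + B * 0.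
    apply: (@ler_cvg_to _ U _ _ (fun k => lagr (x k) + (fine (theta (y k)) -
      dot lbar (y k)) + 2^-1 * d * dz k) (fun k => base + B * e k)).
    - apply: cvgD; first apply: cvgD => //; first apply: cvgB => //.
        by apply: cvg_dot => //; exact: cvg_cst.
      by apply: cvgM => //; exact: cvg_cst.
    - apply: cvgD; first exact: cvg_cst.
      by apply: cvgM => //; exact: cvg_cst.
    - apply: nearW => k; have := upper k; have := edf0 k.
      have := ler_wpM2l (ltW B0) (t2e k).
      by rewrite /augmented -/(df k) -/(dz k); lra.
  have : phi0 xbar + fine (theta (f xbar)) <= phi0 a + fine (theta b).
    rewrite -fab in tdb *; rewrite -lee_fin !EFinD.
    by rewrite -(edomE theta_gtNy tdb) -(edomE theta_gtNy ty).
  rewrite /base /smooth_lagrangian fab mulr0 addr0 => h1 h2.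
  apply/eqP; rewrite -subr_eq0 -dot_eq0 eq_le dot_ge0 andbT.
  by rewrite -(pmulr_rle0 _ d0); lra.
rewrite {}axbar in ac fab Lac fac {ar dphia dfa amin}.
rewrite -{}fab in bc tdb thc.
have xnear : \forall k \near U, \forall x' \near x k, `|x' - xbar| <= rho.
  exact: near_closed_ball ac rho0.
have ynear : \forall k \near U, \forall y' \near y k, `|y' - f xbar| <= rho.
  exact: near_closed_ball bc rho0.
pose l k := lbar + (e k)^-1 *: (f (x k) - y k).
have lsubk : \forall k \near U, subdifferential theta (y k) (l k).
  apply: filterS ynear => k yk.
  apply: (@augmented_stationary_y _ _ _ phi0 f _ lbar theta_gtNy theta_convex _ d (z k)) => //.
  by apply: filterS yk => y' y'r ty'; exact: xymin.
have gradk : \forall k \near U,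
    grad_lagrangian phi0 f (x k) (l k) = - (d *: (x k - z k)).
  apply: filterS xnear => k xk; have [dphik dfk _] := rP3 _ (xr k).
  apply: (@augmented_stationary_x _ _ _ phi0 f theta) => //.
  by apply: filterS xk => x' x'r; exact: xymin.
have gc : (fun k => grad_lagrangian phi0 f (x k) (l k)) @ U --> (0 : 'rV[R]_n).
  have c1 : (fun k => - (d *: (x k - z k))) @ U --> - (d *: (xbar - xbar)).
    by apply: cvgN; apply: cvgZl_tmp; exact: cvgB.
  rewrite subrr scaler0 oppr0 in c1.
  by apply: cvg_trans c1; apply: near_eq_cvg; apply: filterS gradk => k ->.
have lc : l @ U --> lbar.
  exact: (multiplier_cvg phi0_C2 f_C2 theta_gtNy UU uniq ac bc thc gc lsubk).
have KU : \forall k \near U, forall y', subdifferential theta y' (l k) ->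
    sqnorm ((x k, l k) - (xbar, lbar)) <=
    K * sqnorm (grad_lagrangian phi0 f (x k) (l k), y' - f (x k)).
  have pc : (fun k => (x k, l k)) @ U --> (xbar, lbar) by exact: cvg_pair_normed.
  pose S := [set q | forall y', subdifferential theta y' q.2 ->
    sqnorm (q - (xbar, lbar)) <=
      K * sqnorm (grad_lagrangian phi0 f q.1 q.2, y' - f q.1)].
  have KU : U ((fun k => (x k, l k)) @^-1` S) by exact: (pc S KP).
  exact: KU.
have Kd : K * d <= 32^-1.
  rewrite /d ler_pdivrMr// mulKf//.
  have : 0 <= C * K by rewrite mulr_ge0.
  lra.
have Cd : (C + 1) * (K * d) <= 32^-1.
  rewrite mulrA /d ler_pdivrMr// mulKf//.
  by rewrite ler_pM2l ?ltr_wpDl// lerDl.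
have d1 : d <= 32^-1.
  rewrite /d lef_pV2 ?posrE// ler_pMr//.
  have : 0 <= C * K by rewrite mulr_ge0.
  lra.
have eK : \forall k \near U, e k <= (K + 1)^-1.
  by apply: (cvgr_le _ ec); rewrite invr_gt0 ltr_wpDl.
have eW : \forall k \near U, e k < (d * W) / (16 * B).
  by apply: (cvgr_lt _ ec); rewrite divr_gt0 ?mulr_gt0.
have /filter_ex[k [[lk gk Kk] [eKk eWk]]] : \forall k \near U,
    [/\ subdifferential theta (y k) (l k),
      grad_lagrangian phi0 f (x k) (l k) = - (d *: (x k - z k)) &
      forall y', subdifferential theta y' (l k) ->
        sqnorm ((x k, l k) - (xbar, lbar)) <=
        K * sqnorm (grad_lagrangian phi0 f (x k) (l k), y' - f (x k))] /\
    (e k <= (K + 1)^-1 /\ e k < (d * W) / (16 * B)).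
  apply: filterI; last exact: filterI.
  by apply: filterS3 lsubk gradk KU.
have := Kk _ lk; rewrite gk /sqnorm /=.
have -> : y k - f (x k) = - (e k *: (l k - lbar)).
  by rewrite /l [lbar + _]addrC addrK scalerA divff ?gt_eqF// scale1r opprB.
rewrite !dotNl !dotNr !opprK !dotZl !dotZr -/(dx k) -/(dz k).
set dl := dot _ _ => Kdx.
have dl0 : 0 <= dl by exact: dot_ge0.
have Ke : K * e k <= 1.
  apply: le_trans (ler_wpM2l K0 eKk) _.
  by rewrite ler_pdivrMr ?ltr_wpDl// mul1r lerDl.
have ddz0' : 0 <= d * dz k by rewrite mulr_ge0// ltW.
have hl : K * (e k * (e k * dl)) <= dl.
  have h1 : e k * dl <= dl by rewrite ler_piMl.
  have h2 := ler_wpM2r (mulr_ge0 (ltW (e0 k)) dl0) Ke; lra.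
have dxd : dx k <= K * d * (d * dz k) by lra.
have hC : (C + 1) * dx k <= 32^-1 * (d * dz k).
  have h1 : (C + 1) * dx k <= (C + 1) * (K * d * (d * dz k)).
    by rewrite ler_pM2l// ltr_wpDl.
  have := ler_wpM2r ddz0' Cd; lra.
have hx : dx k <= 32^-1 * (32^-1 * dz k).
  have := ler_wpM2r ddz0' Kd; have := ler_wpM2r (dz0 k) d1; lra.
have tW : t k ^+ 2 * W <= 2 * dz k + 2 * dx k.
  have -> : t k ^+ 2 * W = dot (t k *: w) (t k *: w).
    by rewrite dotZl dotZr /W expr2 mulrA.
  have -> : t k *: w = (x k - xbar) - (x k - z k).
    by apply/rowP => i; rewrite !mxE; ring.
  rewrite /dx /dz; move: (x k - xbar) (x k - z k) => p q.
  by have := dot_ge0 (p + q); rewrite !dotE (dotC q p); lra.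
have val : 2^-1 * (d * dz k) - C * dx k <= B * t k ^+ 2 * e k.
  have := upper k; have := lowM k; have := lowL k; have := edf0 k.
  by rewrite /augmented -/(df k) -/(dz k) /base; lra.
have Be : B * e k < d * W / 16.
  by move: eWk; rewrite !ltr_pdivlMr ?mulr_gt0//; lra.
have t20 : 0 < t k ^+ 2 by rewrite exprn_gt0.
have := ler_wpM2l (ltW d0) tW; have := ler_wpM2l (ltW d0) hx.
have Be' : t k ^+ 2 * (B * e k) < t k ^+ 2 * (d * W / 16) by rewrite ltr_pM2l.
have dW0 : 0 < t k ^+ 2 * (d * W) by rewrite !mulr_gt0.
have := dx0 k; lra.
Qed.


End SOSCFromSubregularity.

(** * The equivalence *)

Theorem theorem8p2 (R : realType) (n m : nat)
    (phi0 : 'rV[R]_n -> R) (f : 'rV[R]_n -> 'rV[R]_m)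
    (theta : 'rV[R]_m -> \bar R)
    (xbar : 'rV[R]_n) (lbar : 'rV[R]_m)
    (phi0_C2 : C2_around phi0 xbar)
    (f_C2 : C2_around f xbar)
    (theta_gtNy : forall y, (-oo < theta y)%E)
    (theta_convex : convex_efun theta)
    (theta_plq : piecewise_linear_quadratic theta)
    (fxbar_dom : edom theta (f xbar))
    (xlbar_KKT : KKT phi0 f theta xbar lbar) :
  let cond_i :=
    strongly_metrically_subregular (@prod_enorm R n m) (@prod_enorm R n m)
      (KKT_map phi0 f theta) (xbar, lbar) (0, 0)
    /\ local_minimizer (objective phi0 f theta) xbar in
  let cond_ii :=
    multipliers f theta xbar (- gradient phi0 xbar) = [set lbar]
    /\ SOSC phi0 f theta xbar lbar in
  let cond_iii :=
    SOSC phi0 f theta xbar lbar /\ strong_Robinson_CQ f theta xbar lbar in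
  (cond_i <-> cond_ii) /\ (cond_ii <-> cond_iii).
Proof.
move=> cond_i cond_ii cond_iii.
have [k [ Omega [A [a [alpha]]]]] := theta_plq.
move=> [Opoly Asym domE thE].
have [G0 lP] := xlbar_KKT.
have socP := SOSC_low_curvatureP phi0 theta_gtNy lP.
have i_ii : cond_i -> cond_ii.
  move=> [reg locmin]; split.
    exact: subregular_unique_multiplier theta_gtNy xlbar_KKT reg.
  apply/socP; apply: subregular_SOSC reg locmin => //.
  by move=> U y b UU yd yc; exact: (ultra_lim_plq Opoly domE thE UU yd yc).
have ii_iii : cond_ii -> cond_iii.
  move=> [uniq soc]; split=> //; apply/seteqP; split=> [eta [etaD etaJ]|_ ->].
    have [t t0 sub] := graphical_derivative0_subgradient theta_gtNy theta_convex
      Opoly Asym domE thE lP etaD.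
    have : multipliers f theta xbar (- gradient phi0 xbar) (lbar + t *: eta).
      apply/multipliersE; split=> //.
      by rewrite /grad_lagrangian mulmxDl -scalemxAl etaJ scaler0 addr0.
    rewrite uniq /= => /eqP; rewrite -subr_eq0 addrC addKr scaler_eq0 gt_eqF//=.
    by move=> /eqP.
  split; last by rewrite /= mul0mx.
  apply/tangent_coneP => e e0; exists (e / 2), 0; split.
  - by rewrite divr_gt0//= ltr_pdivrMr// ltr_pMr// ltr1n.
  - by rewrite subrr normr0.
  - by rewrite scaler0 addr0.
have iii_i : cond_iii -> cond_i.
  move=> [/socP soc rcq]; split; last first.
    exact: SOSC_local_minimizer phi0_C2 f_C2 theta_gtNy xlbar_KKT soc.
  apply: SOSC_RCQ_subregular phi0_C2 f_C2 xlbar_KKT soc _ _.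
    move=> u eta etaD.
    exact: (graphical_derivative_low_curvature theta_gtNy Opoly Asym domE thE lP etaD).
  move=> eta etaD etaJ.
  by have : [set 0 : 'rV[R]_m] eta by rewrite -rcq.
by split; split=> // h; [exact: iii_i (ii_iii h)|exact: i_ii (iii_i h)].
Qed.
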